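(* The mapping $D\mapsto I_D=\Gamma(Y,\mathcal O_Y(-D))$ is a one-to-one correspondence between the set of effective divisors $D$ on $Y$ such that $\mathcal O_Y(-D)$ is generated by its global sections, and the set of integrally closed ideals $I$ of $R$ such that $I\cdot\mathcal O_Y$ is an invertible sheaf. The inverse is given by $I\mapsto D_I$, where $D_I$ is the divisor satisfying $I\cdot\mathcal O_Y=\mathcal O_Y(-D_I)$.
   Context: Let $k$ be an algebraically closed field of characteristic zero and $R$ a regular local ring over $k$ of dimension at least $2$ such that $X=\operatorname{Spec} R$ is the germ of a smooth algebraic variety over $k$. Let $\mathfrak a$ be a (nonzero) ideal sheaf on $X$ and let $\pi:Y\to X$ be a fixed log resolution of $(X,\mathfrak a)$: a proper birational morphism with $Y$ smooth, $\mathfrak a\cdot\mathcal O_Y=\mathcal O_Y(-F)$ for an effective Cartier divisor $F$, and $F+\mathrm{Exc}(\pi)$ a simple normal crossing divisor. ''Divisor'' means divisor with integer coefficients. One has $\Gamma(Y,\mathcal O_Y)=R$, so $\Gamma(Y,\mathcal O_Y(-D))$ is regarded as an ideal of $R$ for $D$ effective. *)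

(* Defs.v *)
From HB Require Import structures.
From mathcomp Require Import all_boot all_order all_algebra.
From mathcomp Require Import boolp classical_sets functions cardinality.

Set Implicit Arguments.
Unset Strict Implicit.
Unset Printing Implicit Defensive.

Import GRing.Theory.

Local Open Scope classical_set_scope.
Local Open Scope ring_scope.

(* Everything lives inside one field K, the common function field of X and Y.
   An integral separated scheme with function field K is represented, as in
   Chevalley and Zariski-Samuel (vol. II, ch. VI, par. 17) or EGA I (8.2), by
   the set of its local rings, which are subrings of K; a point of the scheme
   is identified with its local ring.  A subsheaf F of the constant sheaf K is
   represented by the function sending a point O to the stalk F O, a subset of
   K; its sections over the whole scheme form the intersection of the stalks. *)

Section CommutativeAlgebra.
Variable K : fieldType.
Implicit Types (A B O V R I S p : set K) (x : K).

Definition is_subring A : Prop := subring_closed [in A].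

(* A[S], as a subring of K *)
Definition adjoin A S : set K := smallest is_subring (A `|` S).

Definition finite_type A B : Prop := exists s : seq K, B = adjoin A [set` s].

(* the A-submodule of K generated by S; for an ideal I of R and a point O
   above Spec R, span O I is the extension I.O, that is the stalk of I.O_Y *)
Definition span A S : set K :=
  [set x | exists n (a s : 'I_n -> K),
     [/\ forall i, A (a i), forall i, S (s i) & x = \sum_(i < n) a i * s i]].

Definition is_ideal A I : Prop :=
  [/\ I `<=` A, I 0, forall x y, I x -> I y -> I (x + y)
    & forall a x, A a -> I x -> I (a * x)].

Definition ideal_pow A I n : set K :=
  span A [set x | exists f : 'I_n -> K,
            (forall i, I (f i)) /\ x = \prod_(i < n) f i].

Definition integral_over_ideal A I x : Prop :=
  exists n (c : nat -> K),
    (forall i, (0 < i <= n)%N -> ideal_pow A I i (c i)) /\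
    x ^+ n + \sum_(1 <= i < n.+1) c i * x ^+ (n - i) = 0.

Definition integrally_closed_ideal A I : Prop :=
  is_ideal A I /\ forall x, A x -> integral_over_ideal A I x -> I x.

Definition noetherian A : Prop :=
  forall I, is_ideal A I -> exists s : seq K, I = span A [set` s].

Definition is_prime A p : Prop :=
  [/\ is_ideal A p, ~ p 1
    & forall x y, A x -> A y -> p (x * y) -> p x \/ p y].

Definition prime_chain A n (P : nat -> set K) : Prop :=
  (forall i, (i <= n)%N -> is_prime A (P i)) /\
  (forall i, (i < n)%N -> P i `<` P i.+1).

Definition krull_dim A d : Prop :=
  forall n, (exists P, prime_chain A n P) <-> (n <= d)%N.

Definition localization A p : set K :=
  [set x | exists a b, [/\ A a, A b, ~ p b & x = a / b]].

Definition nonunits O : set K := [set x | O x /\ (x = 0 \/ ~ O x^-1)].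

Definition local_ring O : Prop := is_subring O /\ is_ideal O (nonunits O).

Definition regular_parameters O (s : seq K) : Prop :=
  krull_dim O (size s) /\ nonunits O = span O [set` s].

Definition regular_local_ring O : Prop :=
  [/\ local_ring O, noetherian O & exists s, regular_parameters O s].

Definition valuation_ring V : Prop :=
  is_subring V /\ forall x, V x \/ V x^-1.

Definition dominates V O : Prop := O `<=` V /\ nonunits O `<=` nonunits V.

Definition is_fraction_field A : Prop :=
  forall x, exists a b, [/\ A a, A b, b != 0 & x = a / b].

(* the order of x along the discrete valuation ring O; there is none
   for x = 0 *)
Definition has_order O x (n : int) : Prop :=
  exists t u, [/\ nonunits O = span O [set t], O u, ~ nonunits O u
                & x = u * t ^ n].

End CommutativeAlgebra.

Section BirationalModels.
Variable K : fieldType.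
Implicit Types (A O E R I a V : set K) (F : set K -> set K).

(* the points of Spec A *)
Definition Spec A : set (set K) :=
  [set O | exists2 p, is_prime A p & O = localization A p].

(* Spec R is the germ of a smooth variety at a (scheme-theoretic) point.  Over
   an algebraically closed field, smooth means that all local rings are
   regular. *)
Definition germ_of_smooth_variety (k : fieldType) (iota : {rmorphism k -> K})
    R : Prop :=
  exists A, [/\ finite_type (range iota) A,
                forall O, Spec A O -> regular_local_ring O & Spec A R].

(* For R with fraction field K: Y is an integral separated scheme which is
   proper and birational over Spec R.  Y is a finite union of affine schemes of
   finite type over R, and it satisfies the valuative criterion: uniqueness of
   the centre is separatedness (irredundance in the sense of Zariski), and
   existence is properness (completeness).  The morphism to Spec R sends O to
   the localization of R at its intersection with the maximal ideal of O. *)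
Definition proper_birational_model R (Y : set (set K)) : Prop :=
  (exists n (A : 'I_n -> set K),
     (forall i, finite_type R (A i)) /\ Y = \bigcup_i Spec (A i)) /\
  (forall V, valuation_ring V -> R `<=` V ->
     exists! O, Y O /\ dominates V O).

Definition smooth (Y : set (set K)) : Prop :=
  forall O, Y O -> regular_local_ring O.

Definition prime_divisors (Y : set (set K)) : set (set K) :=
  [set E | Y E /\ krull_dim E 1].

(* A divisor with integer coefficients, extended by 0 to all subsets of K so
   that equality of divisors is equality of functions. *)
Definition is_divisor (Y : set (set K)) (D : set K -> int) : Prop :=
  [set E | D E != 0] `<=` prime_divisors Y /\ finite_set [set E | D E != 0].

Definition effective (D : set K -> int) : Prop := forall E, 0 <= D E.

(* The inclusion O `<=` E says that the point O lies on the closure of the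
   point E, i.e. that the prime divisor E passes through O. *)
Definition local_equation (Y : set (set K)) (D : set K -> int) O (f : K) : Prop :=
  f != 0 /\ forall E, prime_divisors Y E -> O `<=` E -> has_order E f (D E).

(* The sheaf O_Y(-D): its stalk at O is generated by a local equation of D at
   O.  Such an equation exists and is unique up to a unit of O when Y is
   smooth, because regular local rings are factorial. *)
Definition sheafN (Y : set (set K)) (D : set K -> int) : set K -> set K :=
  fun O => [set x | exists2 f, local_equation Y D O f & span O [set f] x].

(* The sheaf I.O_Y *)
Definition ideal_sheaf I : set K -> set K := fun O => span O I.

Definition sheaf_eq (Y : set (set K)) (F G : set K -> set K) : Prop :=
  forall O, Y O -> F O = G O.

Definition global_sections (Y : set (set K)) F : set K := \bigcap_(O in Y) F O.

Definition globally_generated (Y : set (set K)) F : Prop :=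
  forall O, Y O -> F O = span O (global_sections Y F).

(* For coherent F (such as I.O_Y), being invertible can be read off the
   stalks. *)
Definition invertible (Y : set (set K)) F : Prop :=
  forall O, Y O -> exists2 g, g != 0 & F O = span O [set g].

(* the points of Y where the morphism to Spec R is not a local isomorphism *)
Definition exceptional_locus R (Y : set (set K)) : set (set K) :=
  Y `\` Spec R.

Definition exceptional_divisor R (Y : set (set K)) : set K -> int :=
  fun E => (E \in prime_divisors Y `&` exceptional_locus R Y)%:Z.

(* Every component of D through a point is cut out there by a member of one
   common regular system of parameters, and in particular is regular. *)
Definition simple_normal_crossing (Y : set (set K)) (D : set K -> int) : Prop :=
  is_divisor Y D /\
  forall O, Y O -> exists2 s : seq K, regular_parameters O s &
    forall E, D E != 0 -> O `<=` E ->
      exists2 x, x \in s & O `&` nonunits E = span O [set x].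

(* The third clause says that the exceptional locus is the support of
   the divisor that represents it. *)
Definition log_resolution R a (Y : set (set K)) : Prop :=
  [/\ proper_birational_model R Y, smooth Y,
      forall O, exceptional_locus R Y O ->
        exists2 E, exceptional_divisor R Y E != 0 & O `<=` E
    & exists F : set K -> int,
        [/\ is_divisor Y F, effective F,
            sheaf_eq Y (ideal_sheaf a) (sheafN Y F)
          & simple_normal_crossing Y
              (fun E => F E + exceptional_divisor R Y E)]].

(* D |-> I_D = Gamma(Y, O_Y(-D)) *)
Definition ideal_of_divisor (Y : set (set K)) (D : set K -> int) : set K :=
  global_sections Y (sheafN Y D).

Definition gg_effective_divisors (Y : set (set K)) : set (set K -> int) :=
  [set D | [/\ is_divisor Y D, effective D & globally_generated Y (sheafN Y D)]].

Definition closed_ideals_invertible_on R (Y : set (set K)) : set (set K) :=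
  [set I | integrally_closed_ideal R I /\ invertible Y (ideal_sheaf I)].

End BirationalModels.

(* Main.v *)
(* Both compositions reduce to two facts.  First, a regular local ring O is the
   intersection of its localizations at primes of height one; this makes local
   equations unique up to units, makes O normal, and shows that an element which
   is integral over an ideal contained in fO lies in fO, so that I_D is
   integrally closed.  It follows from Krull's height theorem: one of two regular
   parameters of O is a prime element that does not divide the other.  Second, if
   x lies in I.O for every point O of Y, then x lies in IV for every valuation
   ring V of K over R, because V dominates a point of Y; hence x is integral over
   I.  For I = R this says Gamma(Y, O_Y) = R.

   Factoriality of regular local rings is not needed: if O_Y(-D) is globally
   generated its stalks are nonempty, so that D has local equations, and for an
   invertible I.O_Y the local generators are local equations of D_I.  The support
   of D_I is finite since every chart of Y is noetherian. *)

Require Import Defs.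
From mathcomp Require Import all_boot all_order all_algebra.
From mathcomp Require Import boolp classical_sets functions cardinality.
From mathcomp Require Import ring.
Import Defs.

Local Open Scope classical_set_scope.
Local Open Scope ring_scope.

(** * Subrings, submodules and ideals *)

Section Submodules.
Set Implicit Arguments.
Unset Strict Implicit.
Import GRing.Theory.
Variable K : fieldType.
Implicit Types (A B I J M N p q S : set K) (x y z : K).

(** All rings are subsets of one field, so dimension theory cannot be run in quotient rings. Working
    modulo I is replaced by working with the ideals that contain I, and localizing at p by
    saturating with respect to the complement of p; Nakayama's lemma, the artinian property and
    Krull's theorem are all put in this relative form. The hard point is that a regular parameter t1
    is prime. The induction passes through the ideals generated by part of a system of parameters
    and needs, at each stage, a parameter outside finitely many primes. It is found among elements t
    + n u with n a natural number; characteristic zero enters here, because nonzero differences of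
    natural numbers are units in every local ring involved. Normality of R cannot be taken from Y,
    since Gamma(Y, O_Y) = R is itself deduced from it. It comes from the codimension one argument
    applied to Spec A, where A is the regular algebra of which R is a local ring. *)

Lemma is_subringP A : is_subring A <->
  [/\ A 1, forall x y, A x -> A y -> A (x - y)
    & forall x y, A x -> A y -> A (x * y)].
Proof.
split=> [[h1 hB hM]|[h1 hB hM]].
  split; first by move: h1; rewrite in_setE.
    by move=> x y /mem_set Ax /mem_set Ay; have := hB x y Ax Ay; rewrite in_setE.
  by move=> x y /mem_set Ax /mem_set Ay; have := hM x y Ax Ay; rewrite in_setE.
split; first by rewrite in_setE.
  by move=> x y; rewrite !in_setE; apply: hB.
by move=> x y; rewrite !in_setE; apply: hM.
Qed.

Section SubringTheory.
Variables (A : set K) (sA : is_subring A).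

Lemma subring1 : A 1. Proof. by case/is_subringP: sA. Qed.
Lemma subringB x y : A x -> A y -> A (x - y).
Proof. by case/is_subringP: sA => _ + _; apply. Qed.
Lemma subringM x y : A x -> A y -> A (x * y).
Proof. by case/is_subringP: sA => _ _; apply. Qed.
Lemma subring0 : A 0. Proof. by rewrite -(subrr 1); apply: subringB; apply: subring1. Qed.
Lemma subringN x : A x -> A (- x).
Proof. by rewrite -sub0r; apply: subringB; apply: subring0. Qed.
Lemma subringD x y : A x -> A y -> A (x + y).
Proof. by move=> Ax Ay; rewrite -[y]opprK; apply: subringB => //; apply: subringN. Qed.
Lemma subringX x n : A x -> A (x ^+ n).
Proof.
move=> Ax; elim: n => [|n IHn]; first by rewrite expr0; apply: subring1.
by rewrite exprS; apply: subringM.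
Qed.
Lemma subring_nat n : A n%:R.
Proof.
elim: n => [|n IHn]; first exact: subring0.
by rewrite -natr1; apply: subringD => //; apply: subring1.
Qed.

End SubringTheory.

Definition submodule A M : Prop :=
  [/\ M 0, forall x y, M x -> M y -> M (x + y)
    & forall a x, A a -> M x -> M (a * x)].

Lemma ideal_submodule A I : is_ideal A I -> submodule A I.
Proof. by case. Qed.

Lemma subring_ideal A : is_subring A -> is_ideal A A.
Proof.
move=> sA; split=> //; [exact: subring0|exact: subringD|exact: subringM].
Qed.

Lemma ideal_sub A I : is_ideal A I -> I `<=` A. Proof. by case. Qed.

Lemma ideal_unit A I : is_ideal A I -> I 1 -> A `<=` I.
Proof. by move=> [_ _ _ IM] I1 x Ax; rewrite -[x]mulr1; apply: IM. Qed.

Section SubmoduleTheory.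
Variables (A M : set K) (sA : is_subring A) (sM : submodule A M).

Lemma submod0 : M 0. Proof. by case: sM. Qed.
Lemma submodD x y : M x -> M y -> M (x + y).
Proof. by case: sM => _ + _; apply. Qed.
Lemma submodM a x : A a -> M x -> M (a * x).
Proof. by case: sM => _ _; apply. Qed.
Lemma submodMr a x : A a -> M x -> M (x * a).
Proof. by rewrite mulrC; apply: submodM. Qed.
Lemma submodN x : M x -> M (- x).
Proof.
by move=> Mx; rewrite -mulN1r; apply: submodM => //; apply: (subringN sA);
  apply: (subring1 sA).
Qed.
Lemma submodB x y : M x -> M y -> M (x - y).
Proof. by move=> Mx My; apply: submodD => //; apply: submodN. Qed.
Lemma submod_sum (T : Type) (r : seq T) (P : pred T) (F : T -> K) :
  (forall i, P i -> M (F i)) -> M (\sum_(i <- r | P i) F i).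
Proof. by move=> h; elim/big_ind: _ => //; [apply: submod0|apply: submodD]. Qed.

End SubmoduleTheory.

Lemma submod_sub A B M : A `<=` B -> submodule B M -> submodule A M.
Proof. by move=> AB [h0 hD hM]; split=> // a x /AB; apply: hM. Qed.

Lemma span_submod A S : is_subring A -> submodule A (span A S).
Proof.
move=> sA; split.
- by exists 0, (fun=> 0), (fun=> 0); split;
    [by case=> ? /[!ltn0]|by case=> ? /[!ltn0]|by rewrite big_ord0].
- move=> x y [n [a [s [Aa Ss ->]]]] [m [b [t [Ab Tt ->]]]].
  pose f (T : Type) (u : 'I_n -> T) (v : 'I_m -> T) (i : 'I_(n + m)) :=
    match fintype.split i with inl j => u j | inr j => v j end.
  exists (n + m)%N, (f _ a b), (f _ s t); split.
  + by move=> i; rewrite /f; case: fintype.split.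
  + by move=> i; rewrite /f; case: fintype.split.
  rewrite big_split_ord /=; congr (_ + _); apply: eq_bigr => i _.
    by rewrite /f; case: fintype.splitP => j /= e; [rewrite (_ : i = j) //; apply: val_inj|
      have := ltn_ord i; rewrite e ltnNge leq_addr].
  rewrite /f; case: fintype.splitP => j /= e.
    by have := ltn_ord j; rewrite -e ltnNge leq_addr.
  by rewrite (_ : i = j) //; apply: val_inj; apply/eqP; rewrite -(eqn_add2l n) e.
- move=> c x Ac [n [a [s [Aa Ss ->]]]]; exists n, (fun i => c * a i), s; split=> //.
    by move=> i; apply: subringM.
  by rewrite mulr_sumr; apply: eq_bigr => i _; rewrite mulrA.
Qed.

Lemma sub_span A S : is_subring A -> S `<=` span A S.
Proof.
move=> sA x Sx; exists 1%N, (fun=> 1), (fun=> x); split=> //.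
  by move=> _; apply: subring1.
by rewrite big_ord1 mul1r.
Qed.

Lemma span_min A S M : submodule A M -> S `<=` M -> span A S `<=` M.
Proof.
move=> sM SM x [n [a [s [Aa Ss ->]]]]; apply: (submod_sum sM) => i _.
by apply: (submodM sM) => //; apply: SM.
Qed.

Lemma span_mono A B S T : is_subring B -> A `<=` B -> S `<=` T ->
  span A S `<=` span B T.
Proof.
move=> sB AB ST; apply: span_min.
  exact: submod_sub AB (span_submod _ sB).
by move=> x /ST; apply: sub_span.
Qed.

Lemma span_ideal A S : is_subring A -> S `<=` A -> is_ideal A (span A S).
Proof.
move=> sA SA; have [h0 hD hM] := span_submod S sA; split=> //.
exact: span_min (ideal_submodule (subring_ideal sA)) SA.
Qed.

Lemma span1P A g x : is_subring A -> span A [set g] x <-> exists2 a, A a & x = a * g.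
Proof.
move=> sA; split; last first.
  by move=> [a Aa ->]; apply: (submodM (span_submod _ sA)) => //; apply: sub_span.
have sM : submodule A [set y | exists2 a, A a & y = a * g].
  split; first by exists 0; rewrite ?mul0r //; apply: subring0.
    by move=> _ _ [a Aa ->] [b Ab ->]; exists (a + b); rewrite ?mulrDl //; apply: subringD.
  by move=> c _ Ac [a Aa ->]; exists (c * a); rewrite ?mulrA //; apply: subringM.
by apply: (span_min sM) => _ ->; exists 1; rewrite ?mul1r //; apply: subring1.
Qed.

(** Passing from A/I to its quotient by the class of x becomes passing from [I] to [addp A I x]. *)
Definition addp A I x : set K := [set z | exists i a, [/\ I i, A a & z = i + a * x]].

Lemma addp_submod A I x : is_subring A -> submodule A I -> submodule A (addp A I x).
Proof.
move=> sA sI; split.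
- exists 0, 0; split; [exact: submod0 sI|exact: subring0|by rewrite mul0r addr0].
- move=> _ _ [i [a [Ii Aa ->]]] [j [b [Ij Ab ->]]]; exists (i + j), (a + b); split.
  + exact: (submodD sI).
  + exact: subringD.
  + by ring.
- move=> c _ Ac [i [a [Ii Aa ->]]]; exists (c * i), (c * a); split.
  + exact: (submodM sI).
  + exact: subringM.
  + by ring.
Qed.

Lemma sub_addp A I x : is_subring A -> I `<=` addp A I x.
Proof. by move=> sA i Ii; exists i, 0; split=> //; [exact: subring0|ring]. Qed.

Lemma mem_addp A I x : is_subring A -> submodule A I -> addp A I x x.
Proof.
move=> sA sI; exists 0, 1; split; [exact: submod0 sI|exact: subring1|by ring].
Qed.

Lemma addp_min A I x M : submodule A M -> I `<=` M -> M x -> addp A I x `<=` M.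
Proof.
by move=> sM IM Mx _ [i [a [/IM Mi Aa ->]]]; apply: (submodD sM) => //; apply: (submodM sM).
Qed.

Lemma addp_ideal A I x : is_subring A -> is_ideal A I -> A x -> is_ideal A (addp A I x).
Proof.
move=> sA idI Ax; have [h0 hD hM] := addp_submod x sA (ideal_submodule idI).
split=> //; exact: addp_min (ideal_submodule (subring_ideal sA)) (ideal_sub idI) Ax.
Qed.

Lemma span_nil A : span A [set` [::]] = [set 0].
Proof.
apply/seteqP; split=> [x [[|n] [a [s [_ Ss ->]]]]|x ->].
- by rewrite big_ord0.
- by have := Ss ord0.
- by exists 0, (fun=> 0), (fun=> 0); split;
    [by case=> ? /[!ltn0]|by case=> ? /[!ltn0]|by rewrite big_ord0].
Qed.

Lemma span_cons A x s : is_subring A ->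
  span A [set` x :: s] = addp A (span A [set` s]) x.
Proof.
move=> sA; apply/seteqP; split.
  apply: span_min; first exact: addp_submod (span_submod _ sA).
  move=> y /=; rewrite inE => /orP[/eqP->|ys].
    exact: mem_addp (span_submod _ sA).
  by apply: sub_addp => //; apply: sub_span.
apply: addp_min; first exact: span_submod.
  by apply: span_mono => // y /=; rewrite inE => ->; rewrite orbT.
by apply: sub_span => //=; rewrite mem_head.
Qed.

End Submodules.

(** * Noetherian rings *)

Section Noetherian.
Set Implicit Arguments.
Unset Strict Implicit.
Import GRing.Theory.
Variable K : fieldType.
Variable A : set K.
Hypotheses (sA : is_subring A) (nA : noetherian A).
Implicit Types (I J M N p q S : set K) (x y z : K).

(** A counterexample always has a strictly larger one; by [choice] these form an increasing
    sequence, and finitely many generators of its union already lie in one member. *)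
Lemma noetherian_ind (P : set K -> Prop) :
  (forall I, is_ideal A I -> (forall J, is_ideal A J -> I `<` J -> P J) -> P I) ->
  forall I, is_ideal A I -> P I.
Proof.
move=> hP I idI; apply: contrapT => nPI.
pose T := {J : set K | is_ideal A J /\ ~ P J}.
have step (t : T) : exists u : T, sval t `<` sval u.
  case: t => J [idJ nPJ] /=; apply: contrapT => nex; apply: nPJ; apply: hP => // L idL JL.
  by apply: contrapT => nPL; apply: nex; exists (exist _ L (conj idL nPL)).
have [f hf] := choice step.
pose g n := sval (iter n f (exist _ I (conj idI nPI))).
have idg n : is_ideal A (g n) by rewrite /g; case: (iter _ _ _) => J [].
have mono n m : (n <= m)%N -> g n `<=` g m.
  move=> /subnK <-; elim: (m - n)%N => [|i IHi] //.
  by apply: subset_trans IHi _; rewrite addSn;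
    case: (hf (iter (i + n) f (exist _ I (conj idI nPI)))).
pose U : set K := [set x | exists n, g n x].
have idU : is_ideal A U.
  split.
  - by move=> x [n]; apply: ideal_sub.
  - by exists 0%N; case: (idg 0%N).
  - move=> x y [n gx] [m gy]; exists (maxn n m).
    apply: (submodD (ideal_submodule (idg _))).
      by apply: mono gx; apply: leq_maxl.
    by apply: mono gy; apply: leq_maxr.
  - by move=> a x Aa [n gx]; exists n; apply: (submodM (ideal_submodule (idg _))).
have [s Us] := nA idU.
have [k hk] : exists k : nat, [set` s] `<=` g k.
  have : forall x, x \in s -> U x by move=> x xs; rewrite Us; apply: sub_span.
  elim: s {Us} => [|x s IHs] hs; first by exists 0%N.
  have [m hm] : exists m : nat, [set` s] `<=` g m.
    by apply: IHs => y ys; apply: hs; rewrite inE ys orbT.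
  have [n gx] := hs x (mem_head _ _); exists (maxn n m) => y /=.
  rewrite inE => /orP[/eqP->|/hm]; first by apply: mono gx; apply: leq_maxl.
  by apply: mono; apply: leq_maxr.
have [_] := hf (iter k f (exist _ I (conj idI nPI))); apply => x gx.
have : U x by exists k.+1.
by rewrite Us; apply: (span_min (ideal_submodule (idg k)) hk).
Qed.

Lemma maximal_ideal_such (P : set K -> Prop) I : is_ideal A I -> P I ->
  exists M, [/\ is_ideal A M, I `<=` M, P M &
    forall J, is_ideal A J -> M `<=` J -> P J -> J `<=` M].
Proof.
move=> idI; move: I idI; apply: noetherian_ind => I idI IH PI.
have [[J [idJ IJ PJ]]|nex] := pselect (exists J, [/\ is_ideal A J, I `<` J & P J]).
  have [M [idM JM PM hM]] := IH J idJ IJ PJ; exists M; split=> //.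
  by apply: subset_trans JM; case: IJ.
exists I; split=> // J idJ IJ PJ; apply: contrapT => nJI.
by apply: nex; exists J.
Qed.

Definition colon N z : set K := [set a | A a /\ N (a * z)].

Lemma colon_ideal N z : submodule A N -> is_ideal A (colon N z).
Proof.
move=> sN; split.
- by move=> a [].
- by split; [exact: subring0|rewrite mul0r; exact: submod0 sN].
- move=> a b [Aa Na] [Ab Nb]; split; first exact: subringD.
  by rewrite mulrDl; apply: (submodD sN).
- move=> a b Aa [Ab Nb]; split; first exact: subringM.
  by rewrite -mulrA; apply: (submodM sN).
Qed.

(** An associated prime of (M + N)/N. Among the annihilators modulo N of elements g of M outside N a
    maximal one is prime: if y g is outside N, its annihilator contains that of g, hence equals
    it. *)
Lemma colon_prime N M z : submodule A N -> submodule A M -> M z -> ~ N z ->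
  exists g, [/\ M g, ~ N g & is_prime A (colon N g)].
Proof.
move=> sN sM Mz nNz.
have [J [idJ _ [g [Mg nNg ->]] maxJ]] := @maximal_ideal_such
  (fun J => exists g, [/\ M g, ~ N g & J = colon N g]) _
  (colon_ideal z sN) (ex_intro _ z (And3 Mz nNz erefl)).
exists g; split=> //; split; first exact: colon_ideal.
  by case=> _; rewrite mul1r.
move=> x y Ax Ay [_ Nxyg]; have [Nyg|nNyg] := pselect (N (y * g)); first by right.
left; apply: (maxJ (colon N (y * g))).
- exact: colon_ideal.
- by move=> a [Aa Na]; split=> //; rewrite mulrCA; apply: (submodM sN).
- by exists (y * g); split=> //; apply: (submodM sM).
- by split=> //; rewrite mulrA.
Qed.

Lemma primeP p x y : is_prime A p -> A x -> A y -> p (x * y) -> ~ p x -> p y.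
Proof. by case=> _ _ pM Ax Ay pxy npx; case: (pM x y Ax Ay pxy). Qed.

Lemma primeM p x y : is_prime A p -> A x -> A y -> ~ p x -> ~ p y -> ~ p (x * y).
Proof. by case=> _ _ pM Ax Ay npx npy /(pM x y Ax Ay) []. Qed.

Lemma primeX p x n : is_prime A p -> A x -> p (x ^+ n) -> p x.
Proof.
move=> pp Ax; elim: n => [|n IHn]; first by rewrite expr0; case: pp.
by rewrite exprS; case: (pp) => _ _ pM /(pM _ _ Ax (subringX sA n Ax)) [|/IHn].
Qed.

Lemma prime0 : is_prime A [set 0].
Proof.
split; first split.
- by move=> _ ->; apply: subring0.
- by [].
- by move=> x y -> ->; rewrite /= addr0.
- by move=> a x _ ->; rewrite /= mulr0.
- by move=> /eqP; rewrite oner_eq0.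
- by move=> x y _ _ /eqP; rewrite mulf_eq0 => /orP[/eqP->|/eqP->]; [left|right].
Qed.

Lemma not_prime I : is_ideal A I -> ~ is_prime A I -> ~ I 1 ->
  exists x y, [/\ A x, A y, I (x * y), ~ I x & ~ I y].
Proof.
move=> idI nI nI1; apply: contrapT => nex; apply: nI; split=> // x y Ax Ay Ixy.
have [|nIx] := pselect (I x); first by left.
have [|nIy] := pselect (I y); first by right.
by case: nex; exists x, y.
Qed.

Lemma addp_proper I x : is_ideal A I -> A x -> ~ I x -> I `<` addp A I x.
Proof.
move=> idI Ax nIx; split; first exact: sub_addp.
by move=> h; apply/nIx/h/mem_addp => //; apply: ideal_submodule.
Qed.

(** If x y is in I while x and y are not, every prime over I lies over I + (x) or I + (y), and
    noetherian induction applies to both. The set found contains the minimal primes over I without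
    singling them out. *)
Lemma finite_primes_below I : is_ideal A I -> exists Q : set (set K),
  [/\ finite_set Q, forall q, Q q -> is_prime A q /\ I `<=` q
    & forall p, is_prime A p -> I `<=` p -> exists2 q, Q q & q `<=` p].
Proof.
move: I; apply: noetherian_ind => I idI IH.
have [pI|npI] := pselect (is_prime A I).
  exists [set I]; split; first exact: finite_set1.
    by move=> q ->; split.
  by move=> p _ Ip; exists I.
have [I1|nI1] := pselect (I 1).
  by exists set0; split=> [|q []|p [_ np1 _] Ip]; [exact: finite_set0|case: np1; apply: Ip].
have [x [y [Ax Ay Ixy nIx nIy]]] := not_prime idI npI nI1.
have [Q [fQ hQ mQ]] := IH _ (addp_ideal sA idI Ax) (addp_proper idI Ax nIx).
have [T [fT hT mT]] := IH _ (addp_ideal sA idI Ay) (addp_proper idI Ay nIy).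
exists (Q `|` T); split; first by rewrite finite_setU.
  move=> q [/hQ|/hT] [pq h]; split=> //; apply: subset_trans h; exact: sub_addp.
move=> p pp Ip; have [/ideal_submodule sp _ pM] := pp.
have [px|py] := pM x y Ax Ay (Ip _ Ixy).
  by have [q Qq qp] := mQ p pp (addp_min sp Ip px); exists q => //; left.
by have [q Qq qp] := mT p pp (addp_min sp Ip py); exists q => //; right.
Qed.

(** In the local ring at p an element of all primes over I is nilpotent modulo I; s is the cleared
    denominator. When I is not prime, relations modulo I + (x) and I + (y) with x y in I are
    multiplied together. *)
Lemma local_radical p I z : is_prime A p -> A z -> is_ideal A I ->
  (forall q, is_prime A q -> I `<=` q -> q `<=` p -> q z) ->
  exists s n, [/\ A s, ~ p s & I (s * z ^+ n)].
Proof.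
move=> pp Az; have [idp np1 _] := pp; move: I; apply: noetherian_ind => I idI IH hI.
have [I1|nI1] := pselect (I 1).
  by exists 1, 0%N; split=> //; [exact: subring1|rewrite mulr1].
have [pI|npI] := pselect (is_prime A I).
  have [Ip|nIp] := pselect (I `<=` p).
    exists 1, 1%N; split=> //; first exact: subring1.
    by rewrite mul1r expr1; apply: hI.
  have [s ns] : exists s, ~ (I s -> p s) by apply/existsNP.
  have [Is nps] : I s /\ ~ p s by apply/not_implyP.
  by exists s, 0%N; split=> //; [exact: (ideal_sub idI)|rewrite mulr1].
have [x [y [Ax Ay Ixy nIx nIy]]] := not_prime idI npI nI1.
have hsub w : A w -> forall q, is_prime A q -> addp A I w `<=` q -> q `<=` p -> q z.
  by move=> Aw q pq wq; apply: hI => //; apply: subset_trans wq; apply: sub_addp.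
have [s [n [As nps [i [a [Ii Aa e]]]]]] :=
  IH _ (addp_ideal sA idI Ax) (addp_proper idI Ax nIx) (hsub x Ax).
have [t [m [At npt [j [b [Ij Ab f]]]]]] :=
  IH _ (addp_ideal sA idI Ay) (addp_proper idI Ay nIy) (hsub y Ay).
exists (s * t), (n + m)%N; split; [exact: subringM|exact: primeM|].
have -> : s * t * z ^+ (n + m) = (s * z ^+ n) * j + (b * y) * i + (a * b) * (x * y).
  by rewrite exprD (_ : s * t * _ = (s * z ^+ n) * (t * z ^+ m)); [rewrite e f; ring|ring].
have sI := ideal_submodule idI.
apply: (submodD sI); first apply: (submodD sI); apply: (submodM sI) => //.
- by apply: subringM => //; apply: subringX.
- exact: subringM.
- exact: subringM.
Qed.

Definition saturated p N := forall s z, A s -> A z -> ~ p s -> N (s * z) -> N z.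

(** For an ideal N this is the contraction to A of its extension to the local ring at p, so that
    saturated ideals stand for the ideals of that local ring. *)
Definition sat p N : set K := [set z | A z /\ exists s, [/\ A s, ~ p s & N (s * z)]].

Lemma sat_ideal p I : is_prime A p -> is_ideal A I -> is_ideal A (sat p I).
Proof.
move=> pp idI; have [_ np1 _] := pp; have sI := ideal_submodule idI; split.
- by move=> x [].
- split; first exact: subring0.
  by exists 1; split=> //; [exact: subring1|rewrite mulr0; apply: submod0 sI].
- move=> x y [Ax [s [As nps Isx]]] [Ay [t [At npt Ity]]]; split; first exact: subringD.
  exists (s * t); split; [exact: subringM|exact: primeM|].
  have -> : s * t * (x + y) = t * (s * x) + s * (t * y) by ring.
  by apply: (submodD sI); apply: (submodM sI).
- move=> a x Aa [Ax [s [As nps Isx]]]; split; first exact: subringM.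
  by exists s; split=> //; rewrite mulrCA; apply: (submodM sI).
Qed.

Lemma sat_saturated p I : is_prime A p -> saturated p (sat p I).
Proof.
move=> pp s z As Az nps [_ [t [At npt Itsz]]]; split=> //; exists (t * s).
by split; [exact: subringM|exact: primeM|rewrite -mulrA].
Qed.

Lemma sub_sat p I : is_prime A p -> I `<=` A -> I `<=` sat p I.
Proof.
move=> [_ np1 _] IA x Ix; split; first exact: IA.
by exists 1; split=> //; [exact: subring1|rewrite mul1r].
Qed.

Lemma sat_mono p I J : I `<=` J -> sat p I `<=` sat p J.
Proof. by move=> IJ x [Ax [s [As nps /IJ]]]; split=> //; exists s. Qed.

Lemma sat_min p I J : saturated p J -> I `<=` J -> sat p I `<=` J.
Proof. by move=> sJ IJ x [Ax [s [As nps /IJ]]]; apply: sJ. Qed.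

Lemma saturated_sub p q I : p `<=` q -> saturated p I -> saturated q I.
Proof. by move=> pq sI s z As Az nqs; apply: sI => // /pq. Qed.

(** Modulo I the local ring at p has p as its only prime, hence is artinian. The induction is on I:
    p is the annihilator of some g modulo I, so I + (g) is one simple step above I, and either every
    C n contains g or, from some index on, none does. *)
Lemma descending_stable p : is_prime A p -> forall I, is_ideal A I -> saturated p I ->
  (forall q, is_prime A q -> I `<=` q -> q `<=` p -> q = p) ->
  forall C : nat -> set K,
    (forall n, [/\ is_ideal A (C n), saturated p (C n), I `<=` C n & C n.+1 `<=` C n]) ->
  exists n, C n `<=` C n.+1.
Proof.
move=> pp; apply: (@noetherian_ind (fun I => saturated p I -> _)) => I idI IH sI hI C hC.
have [I1|nI1] := pselect (I 1).
  exists 0%N => x; have [idC _ _ _] := hC 0%N; have [idC1 _ IC _] := hC 1%N.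
  by move=> /(ideal_sub idC); apply: (ideal_unit idC1); apply: IC.
have [g [Ag nIg pg]] := colon_prime (ideal_submodule idI)
  (ideal_submodule (subring_ideal sA)) (subring1 sA) nI1.
have e : colon I g = p.
  apply: hI => //.
    by move=> x Ix; split; [exact: (ideal_sub idI)|apply: (submodMr (ideal_submodule idI))].
  move=> a [Aa Iag]; apply: contrapT => npa; apply: nIg; exact: (sI a).
have pgI a : p a -> I (a * g) by rewrite -e => -[].
pose G := addp A I g; have idG : is_ideal A G by apply: addp_ideal.
have Cmono n m : (n <= m)%N -> C m `<=` C n.
  move=> /subnK <-; elim: (m - n)%N => [|i IHi] //.
  by apply: subset_trans IHi; rewrite addSn; case: (hC (i + n)%N).
have IG : I `<=` sat p G.
  by apply: subset_trans (sub_sat pp (ideal_sub idG)); apply: sub_addp.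
have prop : I `<` sat p G.
  split=> // /(_ g) h; apply: nIg; apply: h.
  by apply: (sub_sat pp (ideal_sub idG)); apply: mem_addp => //; apply: ideal_submodule.
have satG := sat_saturated (I := G) pp.
have hG q : is_prime A q -> sat p G `<=` q -> q `<=` p -> q = p.
  by move=> pq Gq; apply: hI => //; apply: subset_trans Gq.
have [gC|] := pselect (forall n, C n g).
  apply: (IH _ (sat_ideal pp idG) prop satG hG C) => n; have [idC sC IC CC] := hC n;
    split=> //.
  by apply: sat_min => //; apply: addp_min => //; apply: ideal_submodule.
move=> /existsNP [n0 nCg].
pose D n := sat p (addp A (C (n + n0)%N) g).
have idD n : is_ideal A (addp A (C (n + n0)%N) g) by apply: addp_ideal; case: (hC (n + n0)%N).
have addp_sub M N : M `<=` N -> addp A M g `<=` addp A N g.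
  by move=> MN _ [i [a [/MN Ni Aa ->]]]; exists i, a.
have [n Dn] : exists n, D n `<=` D n.+1.
  apply: (IH _ (sat_ideal pp idG) prop satG hG D) => n; split.
  - exact: sat_ideal.
  - exact: sat_saturated.
  - by apply/sat_mono/addp_sub; case: (hC (n + n0)%N).
  - by apply/sat_mono/addp_sub; rewrite addSn; case: (hC (n + n0)%N).
exists (n + n0)%N => x Cx; have [idC sC IC CC] := hC (n + n0)%N.
have [idC' sC' IC' _] := hC (n + n0).+1; have Ax := ideal_sub idC Cx.
have [_ [s [As nps [i [a [Ci Aa f]]]]]] : D n.+1 x.
  by apply: Dn; apply: (sub_sat pp (ideal_sub (idD _))); apply: sub_addp.
apply: (sC' s) => //; rewrite f; apply: (submodD (ideal_submodule idC')) => //.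
(* The error term a g lies in the larger member of the chain. For a outside p, saturation would
   bring g into C n0; so a is in p and a g is in I. *)
apply: IC'; apply: pgI; apply: contrapT => npa; apply: nCg.
apply: (@Cmono n0 (n + n0)%N); first exact: leq_addl.
apply: (sC a) => //.
have -> : a * g = s * x - i by rewrite f; ring.
by apply: (submodB sA (ideal_submodule idC));
  [apply: (submodM (ideal_submodule idC))|apply: CC].
Qed.

(** Nakayama's lemma for the local ring at p, without determinants: the generators are eliminated
    one by one, and the multiplier s stands for a denominator. *)
Lemma nakayama p N x (us : seq K) : is_prime A p -> submodule A N -> saturated p N ->
  p x -> [set` us] `<=` A ->
  (forall u, u \in us -> exists s w v,
     [/\ A s, ~ p s, N w, span A [set` us] v & s * u = w + x * v]) ->
  forall u, u \in us -> N u.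
Proof.
move=> pp sN satN px; have [idp np1 _] := pp; have Ax := ideal_sub idp px.
have sp := ideal_submodule idp.
elim: us => [|u us IH] // usA hus.
have Au : A u by apply: usA; rewrite /= mem_head.
have [s [w [v [As nps Nw]]]] := hus u (mem_head _ _).
rewrite span_cons // => -[v0 [a [hv0 Aa ->]] e].
(* Since x is in p and s is not, t acts as a unit at p and the relation can be solved for u. *)
pose t := s - x * a.
have At : A t by apply: subringB => //; apply: subringM.
have npt : ~ p t.
  move=> pt; apply: nps; have -> : s = t + a * x by rewrite /t; ring.
  by apply: (submodD sp) => //; apply: (submodM sp).
have et : t * u = w + x * v0.
  by rewrite (_ : t * u = s * u - x * a * u); [rewrite e; ring|rewrite /t; ring].
have Nus : forall y, y \in us -> N y.
  apply: IH => [y /= ys|y ys]; first by apply: usA; rewrite /= inE ys orbT.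
  have [|r [w' [v' [Ar npr Nw']]]] := hus y; first by rewrite inE ys orbT.
  rewrite span_cons // => -[v1 [b [hv1 Ab ->]] f].
  exists (t * r), (t * w' + x * b * w), (b * x * v0 + t * v1); split.
  + exact: subringM.
  + exact: primeM.
  + by apply: (submodD sN); apply: (submodM sN) => //; apply: subringM.
  + have ss := span_submod [set` us] sA.
    by apply: (submodD ss); apply: (submodM ss) => //; apply: subringM.
  + rewrite -mulrA f (_ : t * _ = t * w' + x * t * v1 + x * b * (t * u)); last by ring.
    by rewrite et; ring.
move=> y; rewrite inE => /orP[/eqP->|]; last exact: Nus.
apply: (satN t) => //; rewrite et; apply: (submodD sN) => //.
by apply: (submodM sN) => //; apply: (span_min sN) hv0.
Qed.

End Noetherian.

(** * Krull's height theorem and regular local rings *)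

Section Height.
Set Implicit Arguments.
Unset Strict Implicit.
Import GRing.Theory.
Variable K : fieldType.
Variable A : set K.
Hypotheses (sA : is_subring A) (nA : noetherian A).
Implicit Types (I J M N p q S : set K) (x y z : K).

(* For y in r, the r-saturations of q + (y^n) play the part of the symbolic
   powers of r: modulo x they form a stationary sequence near p, so by Nakayama's
   lemma two consecutive ones agree, which puts y^n in q. *)
Lemma krull_principal_ideal p r q x : is_prime A p -> is_prime A r -> is_prime A q ->
  q `<=` r -> r `<=` p -> p x -> ~ r x ->
  (forall Q, is_prime A Q -> q `<=` Q -> Q x -> Q `<=` p -> Q = p) -> r `<=` q.
Proof.
move=> pp pr pq qr rp px nrx hp y ry.
have [idp _ _] := pp; have [idr _ _] := pr; have [idq _ _] := pq.
have Ax := ideal_sub idp px; have Ay := ideal_sub idr ry.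
pose J n := addp A q (y ^+ n); pose N n := sat A r (J n).
pose C n := sat A p (addp A (N n) x).
have idJ n : is_ideal A (J n) by apply: addp_ideal => //; apply: subringX.
have idN n : is_ideal A (N n) by apply: sat_ideal.
have idX I : is_ideal A I -> is_ideal A (addp A I x) by move=> idI; apply: addp_ideal.
have NS n : N n.+1 `<=` N n.
  apply: sat_mono; apply: addp_min; first exact: ideal_submodule.
    exact: sub_addp.
  rewrite exprS; apply: (submodM (ideal_submodule (idJ n))) => //.
  by apply: mem_addp => //; apply: ideal_submodule.
have addp_sub I M : I `<=` M -> addp A I x `<=` addp A M x.
  by move=> IM _ [i [a [/IM Mi Aa ->]]]; exists i, a.
have [n Cn] : exists n, C n `<=` C n.+1.
  apply: (descending_stable sA nA pp (sat_ideal sA pp (idX _ idq)) (sat_saturated sA pp)).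
    move=> Q pQ qQ Qp; apply: hp => //.
      by apply: subset_trans qQ;
        apply: subset_trans (sub_sat sA pp (ideal_sub (idX _ idq))); apply: sub_addp.
    apply: qQ; apply: (sub_sat sA pp (ideal_sub (idX _ idq))); apply: mem_addp => //.
    exact: ideal_submodule.
  move=> n; split.
  - by apply: sat_ideal => //; apply: idX.
  - exact: sat_saturated.
  - apply: sat_mono; apply: addp_sub; apply: subset_trans (sub_sat sA pr (ideal_sub (idJ n))).
    exact: sub_addp.
  - by apply: sat_mono; apply: addp_sub.
have [us Eus] := nA (idN n).
have usN u : u \in us -> N n u by move=> us_u; rewrite Eus; apply: sub_span.
have NN : N n `<=` N n.+1.
  rewrite {1}Eus; apply: span_min; first exact: ideal_submodule.
  apply: (nakayama sA pp (ideal_submodule (idN _)) _ px).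
  - by apply: saturated_sub rp _; apply: sat_saturated.
  - by move=> u /usN; apply: ideal_sub.
  move=> u /usN Nu.
  have [_ [s [As nps [w [a [Nw Aa e]]]]]] : C n.+1 u.
    apply: Cn; apply: (sub_sat sA pp (ideal_sub (idX _ (idN n)))); exact: sub_addp.
  exists s, w, a; split=> //; last by rewrite e mulrC.
  (* N n is r-saturated and x is outside r, so a lies in N n as soon as x a does. Thus N n lies in N
     n.+1 + x N n locally at p, as Nakayama's lemma requires. *)
  rewrite -Eus; apply: (@sat_saturated _ _ sA _ (J n) pr x a) => //.
  have -> : x * a = s * u - w by rewrite e; ring.
  apply: (submodB sA (ideal_submodule (idN n))); last exact: NS.
  exact: (submodM (ideal_submodule (idN n))).
have [_ [s [As nrs [i [a [qi Aa e]]]]]] : N n.+1 (y ^+ n).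
  apply: NN; apply: (sub_sat sA pr (ideal_sub (idJ n))); apply: mem_addp => //.
  exact: ideal_submodule.
apply: (primeX sA pq (n := n)) => //.
(* The product of s - a y with y ^ n is i, which is in q, whereas s - a y itself is not: otherwise
   it would be in r, and s too, because y is in r. *)
have Asay : A (s - a * y) by apply: subringB => //; apply: subringM.
apply: (primeP pq Asay) => //; first exact: subringX.
  by rewrite mulrBl e exprS; have -> : i + a * (y * y ^+ n) - a * y * y ^+ n = i by ring.
move=> /qr rsay; apply: nrs.
have -> : s = s - a * y + a * y by ring.
have sr := ideal_submodule idr.
by apply: (submodD sr) => //; apply: (submodM sr).
Qed.

Lemma prime_chain_pred l (P : nat -> set K) : prime_chain A l.+1 P -> prime_chain A l P.
Proof.
by move=> [hP sP]; split=> i il; [apply: hP|apply: sP]; apply: leqW.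
Qed.

(** Induction on n: the chain is cut off below p, and p is replaced by a prime r directly under it
    that is shown to be minimal over one element fewer. *)
Theorem krull_height n : forall (xs : seq K) p, size xs = n ->
  is_prime A p -> [set` xs] `<=` p ->
  (forall q, is_prime A q -> [set` xs] `<=` q -> q `<=` p -> q = p) ->
  forall l P, prime_chain A l P -> P l `<=` p -> (l <= n)%N.
Proof.
elim: n => [|n IHn] xs p sxs pp xsp hp [|l] P cP Plp //.
  have [hP sP] := cP.
  have e : [set 0] = p.
    apply: hp; first exact: prime0.
      by move: sxs => /size0nil -> x; rewrite /= in_nil.
    by move=> _ ->; case: pp => /ideal_submodule/submod0.
  have [_ []] := sP l (leqnn _) => x; move=> /Plp; rewrite -e => ->.
  by case: (hP l (leqnSn _)) => /ideal_submodule/submod0.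
have [hP sP] := cP; have [idp _ _] := pp.
have [Pl1 nPl1] := sP l (leqnn _).
have pPl := hP l (leqnSn _).
(* As r is maximal among the primes strictly below p and above P l, p is minimal over r + (x) for
   every x in p outside r. *)
have [||r [idr Plr [pr rp npr] maxr]] := @maximal_ideal_such _ _ sA nA
    (fun J => [/\ is_prime A J, J `<=` p & ~ p `<=` J]) (P l).
- by case: pPl.
- split=> //; first exact: subset_trans Plp.
  by move=> ppl; apply: nPl1; apply: subset_trans Plp ppl.
have [x xxs nrx] : exists2 x, x \in xs & ~ r x.
  apply: contrapT => nex; apply: npr; rewrite (hp r pr) // => x xxs.
  by apply: contrapT => nrx; apply: nex; exists x.
have px : p x by apply: xsp.
have Ax := ideal_sub idp px.
have above q : is_prime A q -> r `<=` q -> q x -> q `<=` p -> q = p.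
  move=> pq rq qx qp; apply/seteqP; split=> //; apply: contrapT => npq; apply: nrx.
  by have [idq _ _] := pq; apply: (maxr q).
(* Locally at p, p is the radical of r + (x), so each remaining generator z satisfies s z ^ m = y +
   a x with y in r. A prime below p that contains x and all these y contains all the z. *)
have [ys [sys ysr hys]] : exists ys : seq K, [/\ size ys = size (rem x xs),
    [set` ys] `<=` r & forall Q, is_prime A Q -> Q `<=` p -> [set` ys] `<=` Q -> Q x ->
      [set` rem x xs] `<=` Q].
  have : [set` rem x xs] `<=` p by move=> z /= /mem_rem /xsp.
  elim: (rem x xs) => [|z zs IH] hz; first by exists [::]; split.
  have [|ys [sys ysr hys]] := IH.
    by move=> w /= wzs; apply: hz; rewrite /= inE wzs orbT.
  have pz : p z by apply: hz; rewrite /= mem_head.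
  have [|s [m [As nps [y [a [ry Aa e]]]]]] := local_radical sA nA pp
     (ideal_sub idp pz) (addp_ideal sA idr Ax).
    move=> q pq rq qp; rewrite (above q) //.
      by apply: subset_trans rq; apply: sub_addp.
    by apply: rq; apply: mem_addp => //; apply: ideal_submodule.
  exists (y :: ys); split; first by rewrite /= sys.
    by move=> w /=; rewrite inE => /orP[/eqP->|/ysr].
  move=> Q pQ Qp hQ Qx w /=; have [idQ _ _] := pQ.
  rewrite inE => /orP[/eqP->|]; last first.
    by apply: hys => // v /= vys; apply: hQ; rewrite /= inE vys orbT.
  apply: (primeX sA pQ (n := m)); first exact: (ideal_sub idp).
  apply: (primeP pQ As); first by apply: subringX => //; apply: (ideal_sub idp).
    rewrite e; apply: (submodD (ideal_submodule idQ)).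
      by apply: hQ; rewrite /= mem_head.
    exact: (submodM (ideal_submodule idQ)).
  by move=> /Qp.
rewrite ltnS; apply: (IHn ys r) (prime_chain_pred cP) Plr => //.
  by rewrite sys size_rem // sxs.
move=> Q pQ ysQ Qr; apply/seteqP; split=> //.
(* A prime T inside p that contains Q and x contains all of xs, hence is p. So p is minimal over Q +
   (x), and r cannot be strictly larger than Q. *)
apply: (krull_principal_ideal pp pr pQ Qr rp px nrx) => T pT QT Tx Tp.
apply: hp => // z zxs; have [->//|zx] := eqVneq z x.
apply: (hys T) => //; first exact: subset_trans QT.
by rewrite /=; apply: contraT => nz; move: zxs;
  rewrite /= (perm_mem (perm_to_rem xxs)) inE (negPf zx) (negPf nz).
Qed.

End Height.

(** * Prime avoidance and prime elements in regular local rings *)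

Section LocalRings.
Set Implicit Arguments.
Unset Strict Implicit.
Import GRing.Theory.
Variable K : fieldType.
Variable O : set K.
Hypotheses (lO : local_ring O).
Implicit Types (I J M N p q S Q : set K) (x y z t : K).

Let sO : is_subring O := lO.1.
Local Notation m := (nonunits O).

Lemma nonunits_ideal : is_ideal O m. Proof. exact: lO.2. Qed.

Lemma unit_neq0 s : O s -> ~ m s -> s != 0.
Proof. by move=> Os nms; apply/eqP => s0; apply: nms; split=> //; left. Qed.

Lemma unit_inv s : O s -> ~ m s -> O s^-1.
Proof. by move=> Os nms; apply: contrapT => nOs; apply: nms; split=> //; right. Qed.

Lemma nonunits_sub I : is_ideal O I -> ~ I 1 -> I `<=` m.
Proof.
move=> idI nI1 x Ix; have Ox := ideal_sub idI Ix; apply: contrapT => nmx; apply: nI1.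
have [_ _ _ h] := idI.
rewrite -(mulVf (unit_neq0 Ox nmx)); apply: h => //; exact: unit_inv.
Qed.

Lemma nonunits1 : ~ m 1.
Proof.
by case=> _ [/eqP|]; rewrite ?oner_eq0 // invr1; apply; apply: subring1.
Qed.

Lemma nonunits_prime : is_prime O m.
Proof.
split; [exact: nonunits_ideal|exact: nonunits1|].
move=> x y Ox Oy mxy; apply: contrapT => /not_orP[nmx nmy]; apply: nonunits1.
rewrite -(mulVf (mulf_neq0 (unit_neq0 Ox nmx) (unit_neq0 Oy nmy))).
apply: (submodM (ideal_submodule nonunits_ideal)) => //.
by rewrite invfM; apply: subringM => //; apply: unit_inv.
Qed.

Lemma submodule_unit N s z : submodule O N -> O s -> ~ m s -> N (s * z) -> N z.
Proof.
move=> sN Os nms Nsz; have -> : z = s^-1 * (s * z).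
  by rewrite mulrA mulVf ?mul1r //; apply: unit_neq0.
by apply: (submodM sN) => //; apply: unit_inv.
Qed.

Hypothesis nO : noetherian O.
Hypothesis char0O : forall n, n.+1%:R != 0 :> K /\ O n.+1%:R^-1.

Lemma nat_unit n : ~ m n.+1%:R.
Proof. by have [n0 On] := char0O n => -[_ [/eqP|//]]; rewrite (negPf n0). Qed.

(** Each q contains t + n u for at most one n: two such n differ by a unit of O, which would put u,
    and then t, into q. Avoidance from some c on allows the bounds for the several q to be
    combined. *)
Lemma pencil_avoids_primes (Q : seq (set K)) t u : O t -> O u ->
  (forall q, q \in Q -> is_prime O q /\ (~ q t \/ ~ q u)) ->
  exists c : nat, forall n, (c <= n)%N -> forall q, q \in Q -> ~ q (t + n%:R * u).
Proof.
move=> Ot Ou; elim: Q => [|q Q IHQ] hQ; first by exists 0%N.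
have [|c hc] := IHQ; first by move=> r rQ; apply: hQ; rewrite inE rQ orbT.
have [pq tu] := hQ q (mem_head _ _); have [idq nq1 _] := pq.
have sq := ideal_submodule idq.
have diff a b : q (t + a%:R * u) -> q (t + b%:R * u) -> (a < b)%N -> False.
  move=> qa qb /subnKC e.
  have qu : q u.
    apply: (submodule_unit sq (subring_nat sO (b - a.+1).+1) (@nat_unit _)).
    have -> : (b - a.+1).+1%:R = b%:R - a%:R :> K
      by rewrite -[in RHS]e addSnnS natrD addrAC subrr add0r.
    have -> : (b%:R - a%:R) * u = (t + b%:R * u) - (t + a%:R * u) by ring.
    exact: (submodB sO sq).
  case: tu => // nqt; apply: nqt; have -> : t = (t + a%:R * u) - a%:R * u by ring.
  apply: (submodB sO sq) => //; apply: (submodM sq) => //; exact: subring_nat.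
have [[n0 qn0]|nex] := pselect (exists n, q (t + n%:R * u)).
  exists (maxn c n0.+1) => n; rewrite geq_max => /andP[cn n0n] r.
  by rewrite inE => /orP[/eqP->|rQ]; [move=> qn; apply: diff n0n|apply: hc].
exists c => n cn r; rewrite inE => /orP[/eqP->|rQ]; last exact: hc.
by move=> qn; apply: nex; exists n.
Qed.

(** Prime avoidance inside the coset t + (ts), by adding a multiple of one generator at a time; once
    t has left a prime, later additions are chosen not to re-enter it. *)
Lemma coset_avoids_primes (Q : seq (set K)) (ts : seq K) t : O t -> [set` ts] `<=` O ->
  (forall q, q \in Q -> is_prime O q /\ exists2 x, x \in t :: ts & ~ q x) ->
  exists2 b, span O [set` ts] b & forall q, q \in Q -> ~ q (t + b).
Proof.
elim: ts t => [|u ts IH] t Ot tsO hQ.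
  exists 0; first by apply: submod0 (span_submod _ sO).
  move=> q /hQ [_ [x]]; rewrite inE => /eqP -> nqt; by rewrite addr0.
have Ou : O u by apply: tsO; rewrite /= mem_head.
(* Primes containing both t and u cannot be left at this stage; some later generator lies outside
   them. *)
have [|c hc] := @pencil_avoids_primes [seq q <- Q | `[< ~ q t \/ ~ q u >]] t u Ot Ou.
  by move=> q; rewrite mem_filter => /andP[/asboolP h /hQ []].
have {}hc := hc c (leqnn c).
have [|||b sb hb] := IH (t + c%:R * u).
- apply: subringD => //; apply: subringM => //; exact: subring_nat.
- by move=> x /= xts; apply: tsO; rewrite /= inE xts orbT.
- move=> q qQ; have [pq [x xtu nqx]] := hQ q qQ; split=> //.
  have [tu|ntu] := pselect (~ q t \/ ~ q u).
    exists (t + c%:R * u); first by rewrite mem_head.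
    by apply: hc; rewrite mem_filter qQ andbT; apply/asboolP.
  exists x => //; move: xtu; rewrite !inE => /or3P[/eqP e|/eqP e|->]; last by rewrite orbT.
    by case: ntu; left; rewrite -e.
  by case: ntu; right; rewrite -e.
exists (c%:R * u + b); last by move=> q qQ; rewrite addrA; apply: hb.
have ss := span_submod [set` u :: ts] sO; apply: (submodD ss).
  apply: (submodM ss); first exact: subring_nat.
  by apply: sub_span => //=; rewrite mem_head.
by apply: span_mono sb => // x /= xts; rewrite inE xts orbT.
Qed.

(* The last hypothesis says that dim O/J is at least the number of the ts, in
   terms of systems of parameters: in this form it passes to J + (t) at once.
   By induction J + (t) is prime for a generic t in t1 + (ts), and a prime q with
   J <= q <= J + (t) avoiding t satisfies q = J + tq, hence q = J. *)
Lemma regular_quotient_prime (ts : seq K) J : is_ideal O J -> J `<=` m ->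
  [set` ts] `<=` m ->
  (forall M, submodule O M -> J `<=` M -> [set` ts] `<=` M -> m `<=` M) ->
  (forall us : seq K, [set` us] `<=` m ->
    (forall q, is_prime O q -> J `<=` q -> [set` us] `<=` q -> m `<=` q) ->
    (size ts <= size us)%N) ->
  is_prime O J.
Proof.
have idm := nonunits_ideal; have mO := ideal_sub idm; have pm := nonunits_prime.
elim: ts J => [|t1 ts IH] J idJ Jm tsm gen dim; have sJ := ideal_submodule idJ.
  by rewrite (_ : J = m) //; apply/seteqP; split=> //; apply: gen.
have [Q [/finite_seqP [s Qs] hQ mQ]] := finite_primes_below sO nO idJ.
(* Primes containing m are dropped from the list because t itself has to lie in m. *)
have [||q|b sb hb] := @coset_avoids_primes [seq q <- s | `[< ~ m `<=` q >]] ts t1.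
- by apply/mO/tsm; rewrite /= mem_head.
- by move=> x /= xts; apply/mO/tsm; rewrite /= inE xts orbT.
- rewrite mem_filter => /andP[/asboolP nmq qs].
  have [pq Jq] : is_prime O q /\ J `<=` q by apply: hQ; rewrite Qs.
  split=> //; apply: contrapT => nex; apply: nmq.
  apply: gen => //; first by case: pq => /ideal_submodule.
  by move=> x xts; apply: contrapT => nqx; apply: nex; exists x.
pose t := t1 + b; have mt : m t.
  apply: (submodD (ideal_submodule idm)); first by apply: tsm; rewrite /= mem_head.
  apply: span_min sb; first exact: ideal_submodule.
  by move=> x /= xts; apply: tsm; rewrite /= inE xts orbT.
have Ot := mO _ mt.
have pJ' : is_prime O (addp O J t).
  apply: IH.
  - exact: addp_ideal.
  - by apply: addp_min => //; apply: ideal_submodule.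
  - by move=> x /= xts; apply: tsm; rewrite /= inE xts orbT.
  - move=> M sM JM tsM; apply: gen => //.
      by apply: subset_trans JM; apply: sub_addp.
    move=> x /=; rewrite inE => /orP[/eqP->|/tsM//].
    have -> : t1 = t - b by rewrite /t; ring.
    apply: (submodB sO sM); first by apply: JM; apply: mem_addp.
    by apply: span_min sb.
  - move=> us usm hus; rewrite -ltnS; apply: (dim (t :: us)) => [x|q pq Jq usq].
      by rewrite /= inE => /orP[/eqP->|/usm].
    have sq : submodule O q by case: pq => /ideal_submodule.
    apply: hus => //.
      by apply: addp_min => //; apply: usq; rewrite /= mem_head.
    by move=> x /= xus; apply: usq; rewrite /= inE xus orbT.
have [q [pq Jq qJ' nqt]] : exists q, [/\ is_prime O q, J `<=` q, q `<=` addp O J t & ~ q t].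
  have sub T : is_prime O T -> J `<=` T -> ~ m `<=` T ->
      exists q, [/\ is_prime O q, J `<=` q, q `<=` T & ~ q t].
    move=> pT JT nmT; have [q Qq qT] := mQ T pT JT.
    have [pq Jq] := hQ q Qq; exists q; split=> //; apply: hb.
    rewrite mem_filter; apply/andP; split; last by move: Qq; rewrite Qs.
    by apply/asboolP => mq; apply: nmT; apply: subset_trans qT.
  have [mJ'|nmJ'] := pselect (m `<=` addp O J t); last first.
    by apply: sub => //; apply: sub_addp.
  (* Here J + (t) contains m. If every prime over J contained m, the empty list would satisfy the
     test in [dim], although t1 :: ts is not empty. *)
  have [T [pT JT nmT]] : exists T, [/\ is_prime O T, J `<=` T & ~ m `<=` T].
    apply: contrapT => nex; suff : (size (t1 :: ts) <= 0)%N by [].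
    apply: (dim [::]) => [x|T pT JT _]; first (by rewrite /= in_nil); apply: contrapT => nmT.
    by apply: nex; exists T.
  have [q [pq Jq qT nqt]] := sub T pT JT nmT; exists q; split=> //.
  by apply: subset_trans mJ'; apply: nonunits_sub; case: pq.
rewrite (_ : J = q) //; apply/seteqP; split=> //.
have [idq nq1 _] := pq; have [us Eus] := nO idq.
rewrite Eus; apply: span_min => //.
have usq u : u \in us -> q u by move=> us_u; rewrite Eus; apply: sub_span.
apply: (nakayama sO pm sJ _ mt).
- by move=> a z Oa _; apply: submodule_unit.
- by move=> u /usq; apply: ideal_sub.
move=> u /usq qu; have [j [a [Jj Oa e]]] := qJ' u qu.
exists 1, j, a; split=> //; [exact: subring1|exact: nonunits1| |by rewrite e; ring].
rewrite -Eus; apply: (primeP pq Ot Oa _ nqt).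
have -> : t * a = u - j by rewrite e; ring.
by apply: (submodB sO (ideal_submodule idq)) => //; apply: Jq.
Qed.

(** By Krull's height theorem fewer elements than the dimension never cut out m. This gives the
    dimension hypothesis of [regular_quotient_prime] for J = (t1), and excludes both t1 = 0 and t2
    in (t1). *)
Lemma regular_parameter_prime t1 t2 (ts : seq K) :
  regular_parameters O [:: t1, t2 & ts] ->
  [/\ t1 != 0, is_prime O (span O [set t1]) & ~ span O [set t1] t2].
Proof.
move=> [dO em]; have [idm nm1 _] := nonunits_prime; have sm := ideal_submodule idm.
have mem x : x \in [:: t1, t2 & ts] -> m x by move=> xts; rewrite em; apply: sub_span.
have dim (us : seq K) : [set` us] `<=` m ->
    (forall q, is_prime O q -> [set` us] `<=` q -> m `<=` q) -> ((size ts).+2 <= size us)%N.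
  move=> usm hus; have [_ /(_ (leqnn _)) [P cP]] := dO (size ts).+2.
  have pP : is_prime O (P (size ts).+2) by case: cP => + _; apply.
  apply: (krull_height sO nO erefl nonunits_prime usm _ cP).
    by move=> q pq usq qm; apply/seteqP; split=> //; apply: hus.
  by apply: nonunits_sub; case: pP.
have gen M : submodule O M -> [set` [:: t1, t2 & ts]] `<=` M -> m `<=` M.
  by move=> sM tsM; rewrite em; apply: span_min.
have mt1 : m t1 by apply: mem; rewrite mem_head.
have Ot1 : [set t1] `<=` O by move=> _ ->; apply: (ideal_sub idm).
have st1 := span_submod [set t1] sO.
have t1m : span O [set t1] `<=` m by apply: span_min => // _ ->.
have t1t1 : span O [set t1] t1 by apply: sub_span.
(* If t lay in every prime over the other parameters, these alone would cut out m, and there is one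
   too few of them. *)
have minimal t us : perm_eq [:: t1, t2 & ts] (t :: us) ->
    ~ forall q, is_prime O q -> [set` us] `<=` q -> q t.
  move=> tus hq; suff : ((size ts).+2 <= size us)%N.
    by rewrite -[X in (X <= _)%N]/(size [:: t1, t2 & ts]) (perm_size tus) ltnn.
  have usE := perm_mem tus; apply: dim => [x /= xus|q pq usq].
    by apply: mem; rewrite usE inE xus orbT.
  apply: gen => [|x]; first by case: pq => /ideal_submodule.
  by rewrite /= usE inE => /orP[/eqP->|/usq//]; apply: hq.
split.
- apply/eqP => t10; apply: (minimal t1 (t2 :: ts)) => // q [/ideal_submodule/submod0 q0 _ _] _.
  by rewrite t10.
- apply: (regular_quotient_prime (ts := t2 :: ts)) => //.
  - exact: span_ideal.
  - by move=> x /= xts; apply: mem; rewrite inE xts orbT.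
  - move=> M sM t1M tsM; apply: gen => // x /=; rewrite inE => /orP[/eqP->|/tsM//].
    exact: t1M.
  - move=> us usm hus; rewrite -ltnS; apply: (dim (t1 :: us)) => [x|q pq usq].
      by rewrite /= inE => /orP[/eqP->|/usm].
    apply: hus => //.
      apply: span_min; first by case: pq => /ideal_submodule.
      by move=> _ ->; apply: usq; rewrite /= mem_head.
    by move=> x /= xus; apply: usq; rewrite /= inE xus orbT.
- move=> t12; apply: (minimal t2 (t1 :: ts)) => [|q pq tsq].
    by rewrite (perm_catCA [:: t1] [:: t2]).
  have sq : submodule O q by case: pq => /ideal_submodule.
  by apply: (span_min sq) t12 => _ ->; apply: tsq; rewrite /= mem_head.
Qed.

End LocalRings.

(** * Localization *)

Section Localization.
Set Implicit Arguments.
Unset Strict Implicit.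
Import GRing.Theory.
Variable K : fieldType.
Variables A p : set K.
Hypotheses (sA : is_subring A) (pp : is_prime A p).
Implicit Types (q Q : set K) (x y z : K).

Local Notation L := (localization A p).

Let sp : submodule A p. Proof. by case: pp => /ideal_submodule. Qed.
Let pA : p `<=` A. Proof. by case: pp => /ideal_sub. Qed.

Lemma not_prime_neq0 b : ~ p b -> b != 0.
Proof. by move=> npb; apply/eqP => b0; apply: npb; rewrite b0; apply: submod0 sp. Qed.

Lemma sub_localization : A `<=` L.
Proof.
move=> a Aa; exists a, 1; split; rewrite ?divr1 //; first exact: subring1.
by case: pp.
Qed.

Lemma localization_inv b : A b -> ~ p b -> L b^-1.
Proof. by move=> Ab npb; exists 1, b; rewrite div1r; split=> //; apply: subring1. Qed.

Lemma localization_subring : is_subring L.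
Proof.
apply/is_subringP; split; first exact: sub_localization (subring1 sA).
  move=> _ _ [a [b [Aa Ab npb ->]]] [c [d [Ac Ad npd ->]]].
  exists (a * d - c * b), (b * d); split.
  - by apply: subringB => //; apply: subringM.
  - exact: subringM.
  - exact: (primeM pp).
  - by have b0 := not_prime_neq0 npb; have d0 := not_prime_neq0 npd; field; rewrite ?b0 ?d0.
move=> _ _ [a [b [Aa Ab npb ->]]] [c [d [Ac Ad npd ->]]].
exists (a * c), (b * d); split; [exact: subringM|exact: subringM|exact: (primeM pp)|].
by have b0 := not_prime_neq0 npb; have d0 := not_prime_neq0 npd; field; rewrite ?b0 ?d0.
Qed.

Definition extend_prime q : set K :=
  [set x | exists a b, [/\ q a, A b, ~ p b & x = a / b]].

Lemma extend_prime_ideal q : is_ideal A q -> is_ideal L (extend_prime q).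
Proof.
move=> idq; have sq := ideal_submodule idq; split.
- by move=> _ [a [b [qa Ab npb ->]]]; exists a, b; split=> //; apply: (ideal_sub idq).
- exists 0, 1; split; [exact: submod0 sq|exact: subring1|by case: pp|by rewrite mul0r].
- move=> _ _ [a [b [qa Ab npb ->]]] [c [d [qc Ad npd ->]]].
  exists (d * a + b * c), (b * d); split; [|exact: subringM|exact: (primeM pp)|].
    by apply: (submodD sq); apply: (submodM sq).
  by have b0 := not_prime_neq0 npb; have d0 := not_prime_neq0 npd; field; rewrite ?b0 ?d0.
- move=> _ _ [c [d [Ac Ad npd ->]]] [a [b [qa Ab npb ->]]].
  exists (c * a), (d * b); split; [|exact: subringM|exact: (primeM pp)|].
    exact: (submodM sq).
  by have b0 := not_prime_neq0 npb; have d0 := not_prime_neq0 npd; field; rewrite ?b0 ?d0.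
Qed.

Lemma extend_prime_restrict q x : is_prime A q -> q `<=` p -> A x -> extend_prime q x -> q x.
Proof.
move=> pq qp Ax [a [b [qa Ab npb e]]]; apply: (primeP pq Ab Ax); last by move=> /qp.
by rewrite e mulrC divfK ?not_prime_neq0.
Qed.

Lemma extend_prime_prime q : is_prime A q -> q `<=` p -> is_prime L (extend_prime q).
Proof.
move=> pq qp; have [idq nq1 _] := pq; split; first exact: extend_prime_ideal.
  by move/(extend_prime_restrict pq qp (subring1 sA)).
move=> _ _ [a [b [Aa Ab npb ->]]] [c [d [Ac Ad npd ->]]] h.
have Aac : A (a * c) by apply: subringM.
have qac : q (a * c).
  apply: (extend_prime_restrict pq) => //.
  have -> : a * c = (b * d) * (a / b * (c / d)).
    by have b0 := not_prime_neq0 npb; have d0 := not_prime_neq0 npd; field; rewrite ?b0 ?d0.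
  apply: (submodM (ideal_submodule (extend_prime_ideal idq))) h.
  by apply: sub_localization; apply: subringM.
by case: pq => _ _ /(_ _ _ Aa Ac qac) [qa|qc]; [left; exists a, b|right; exists c, d].
Qed.

Lemma nonunits_localization : nonunits L = extend_prime p.
Proof.
apply/seteqP; split=> [x [[a [b [Aa Ab npb e]]] h]|x [a [b [pa Ab npb e]]]].
  exists a, b; split=> //; apply: contrapT => npa.
  have a0 := not_prime_neq0 npa; have b0 := not_prime_neq0 npb; case: h => [x0|].
    by move: (mulf_neq0 a0 (invr_neq0 b0)); rewrite -e x0 eqxx.
  by apply; exists b, a; split=> //; rewrite e invf_div.
split; first by exists a, b; split=> //; apply: pA.
have [->|x0] := eqVneq x 0; [by left|right].
move=> [c [d [Ac Ad npd f]]]; apply: (primeM pp Ab Ad npb npd).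
have b0 := not_prime_neq0 npb; have d0 := not_prime_neq0 npd.
have -> : b * d = c * a; last exact: (submodM sp).
by rewrite -[LHS]mulr1 -(mulfV x0) f {1}e; field; rewrite ?b0 ?d0.
Qed.

Lemma restrict_prime Q : is_prime L Q -> is_prime A (A `&` Q).
Proof.
move=> [idQ nQ1 QM]; have sQ := submod_sub sub_localization (ideal_submodule idQ).
split; first split.
- by move=> x [].
- by split; [exact: subring0|exact: submod0 sQ].
- by move=> x y [Ax Qx] [Ay Qy]; split; [exact: subringD|exact: (submodD sQ)].
- by move=> a x Aa [Ax Qx]; split; [exact: subringM|exact: (submodM sQ)].
- by case.
- move=> x y Ax Ay [_ /(QM _ _ (sub_localization Ax) (sub_localization Ay))].
  by case; [left|right].
Qed.

Lemma localization_localization Q : is_prime L Q ->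
  localization L Q = localization A (A `&` Q).
Proof.
move=> pQ; have [idQ _ _] := pQ; have sQ := ideal_submodule idQ.
have Lp b : A b -> ~ p b -> ~ Q b.
  move=> Ab npb Qb; case: (pQ) => _ + _; apply.
  rewrite -(mulVf (not_prime_neq0 npb)); apply: (submodM sQ) => //.
  exact: localization_inv.
apply/seteqP; split=> [_ [_ [_ [[a [b [Aa Ab npb ->]]] [c [d [Ac Ad npd ->]]] nQ ->]]]|].
  have b0 := not_prime_neq0 npb; have d0 := not_prime_neq0 npd.
  have c0 : c != 0.
    by apply/eqP => c0; apply: nQ; rewrite c0 mul0r; apply: submod0 sQ.
  exists (a * d), (b * c); split; [exact: subringM|exact: subringM| |].
    move=> [_ Qbc]; apply: nQ; have -> : c / d = (b^-1 * d^-1) * (b * c).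
      by field; rewrite ?b0 ?d0.
    apply: (submodM sQ) => //; apply: subringM; first exact: localization_subring.
      exact: localization_inv.
    exact: localization_inv.
  by field; rewrite ?b0 ?c0 ?d0.
move=> _ [a [b [Aa Ab nQb ->]]]; exists a, b; split=> //; try exact: sub_localization.
by move=> Qb; apply: nQb.
Qed.

End Localization.

Section SpecLocalization.
Set Implicit Arguments.
Unset Strict Implicit.
Import GRing.Theory.
Variable K : fieldType.
Implicit Types (A O p q : set K).

(** Charts, and hence Y, are stable under generization; the codimension one argument relies on this
    when it moves from O to the local ring at a prime of O. *)
Lemma Spec_localization A O q : is_subring A -> Spec A O -> is_prime O q ->
  Spec A (localization O q).
Proof.
move=> sA [p pp ->] pq; exists (A `&` q); first exact: (restrict_prime sA pp).
exact: localization_localization.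
Qed.

Lemma Spec_sub A O : is_subring A -> Spec A O -> A `<=` O.
Proof. by move=> sA [p pp ->]; apply: sub_localization. Qed.

Lemma Spec_subring A O : is_subring A -> Spec A O -> is_subring O.
Proof. by move=> sA [p pp ->]; apply: localization_subring. Qed.

Lemma fraction_field_sub A O : is_subring A -> A `<=` O -> is_fraction_field A ->
  is_fraction_field O.
Proof.
by move=> sA AO fA x; have [a [b [Aa Ab b0 ->]]] := fA x; exists a, b; split=> //; apply: AO.
Qed.

Lemma fraction_field_Spec A O : is_subring A -> Spec A O -> is_fraction_field O ->
  is_fraction_field A.
Proof.
move=> sA [p pp ->] fO x.
have [_ [_ [[a [b [Aa Ab npb ->]]] [c [d [Ac Ad npd ->]]] cd0 ->]]] := fO x.
have b0 := not_prime_neq0 pp npb; have d0 := not_prime_neq0 pp npd.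
have c0 : c != 0 by apply: contraNneq cd0 => ->; rewrite mul0r.
exists (a * d), (b * c); split; [exact: subringM|exact: subringM|by rewrite mulf_neq0|].
by field; rewrite ?b0 ?c0 ?d0.
Qed.

Lemma adjoin_subring A S : is_subring (adjoin A S).
Proof.
apply/is_subringP; split.
- by move=> B [sB _]; apply: subring1.
- by move=> x y hx hy B hB; apply: subringB; [case: hB|apply: hx|apply: hy].
- by move=> x y hx hy B hB; apply: subringM; [case: hB|apply: hx|apply: hy].
Qed.

Lemma sub_adjoin A S : A `|` S `<=` adjoin A S.
Proof. by move=> x ASx B [_]; apply. Qed.

Lemma adjoin_min A B S : is_subring B -> A `|` S `<=` B -> adjoin A S `<=` B.
Proof. by move=> sB ASB x; apply. Qed.

Lemma finite_type_subring A B : finite_type A B -> is_subring B /\ A `<=` B.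
Proof.
move=> [s ->]; split; first exact: adjoin_subring.
by move=> x Ax; apply: sub_adjoin; left.
Qed.

End SpecLocalization.

(** * Discrete valuation rings and codimension one *)

Section DiscreteValuationRings.
Set Implicit Arguments.
Unset Strict Implicit.
Import Order.TTheory GRing.Theory Num.Theory.
Variable K : fieldType.
Variable O : set K.
Hypotheses (rO : regular_local_ring O) (fO : is_fraction_field O).
Implicit Types (x y t u w : K) (n : int).

Let lO : local_ring O. Proof. by case: rO. Qed.
Let nO : noetherian O. Proof. by case: rO. Qed.
Let sO : is_subring O := lO.1.
Let idm : is_ideal O (nonunits O) := lO.2.
Let sm : submodule O (nonunits O) := ideal_submodule idm.
Let pm : is_prime O (nonunits O) := nonunits_prime lO.

Definition unit_of u : Prop := O u /\ ~ nonunits O u.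

Lemma unit_of_neq0 u : unit_of u -> u != 0.
Proof. by case; apply: unit_neq0. Qed.

Lemma unit_of1 : unit_of 1.
Proof. by split; [exact: subring1|exact: nonunits1]. Qed.

Lemma unit_ofM u w : unit_of u -> unit_of w -> unit_of (u * w).
Proof.
by move=> [Ou nu] [Ow nw]; split; [exact: subringM|exact: (primeM pm)].
Qed.

Lemma unit_ofV u : unit_of u -> unit_of u^-1.
Proof.
move=> [Ou nu]; have Ou' := unit_inv Ou nu; split=> // mu'; apply: (nonunits1 lO).
by rewrite -(mulfV (unit_neq0 Ou nu)); apply: (submodM sm).
Qed.

Lemma unit_of_expz u n : unit_of u -> unit_of (u ^ n).
Proof.
move=> uu; have h k : unit_of (u ^+ k).
  by elim: k => [|k IHk]; [rewrite expr0; apply: unit_of1|rewrite exprS; apply: unit_ofM].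
by case: n => k; [exact: h|exact: unit_ofV (h _)].
Qed.

Lemma unit_ofE u : u != 0 -> unit_of u <-> O u /\ O u^-1.
Proof.
move=> u0; split=> [[Ou nu]|[Ou Ou']]; first by split=> //; apply: unit_inv.
by split=> // -[_ [/eqP|//]]; rewrite (negPf u0).
Qed.

Lemma span1_eq x y : x != 0 -> span O [set x] = span O [set y] ->
  exists2 u, unit_of u & y = u * x.
Proof.
move=> x0 e.
have /span1P-/(_ sO) [a Oa ya] : span O [set x] y by rewrite e; apply: sub_span.
have /span1P-/(_ sO) [b Ob xb] : span O [set y] x by rewrite -e; apply: sub_span.
exists a => //; have ba1 : b * a = 1.
  by apply: (mulIf x0); rewrite mul1r -mulrA -ya -xb.
have a0 : a != 0 by apply/eqP => a0; move: ba1; rewrite a0 mulr0 => /eqP;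
  rewrite eq_sym oner_eq0.
apply/(unit_ofE a0); split=> //; rewrite -[a^-1]mul1r -ba1 mulfK //.
Qed.

Hypothesis dO : krull_dim O 1.

Lemma uniformizer : exists2 t, t != 0 & nonunits O = span O [set t].
Proof.
have [_ _ [s [ds e]]] := rO.
have s1 : size s = 1%N.
  apply/eqP; rewrite eqn_leq; apply/andP; split.
    by apply/dO/ds.
  by apply/ds/dO.
case: s s1 e {ds} => [|t [|//]] // _ e.
have et : nonunits O = span O [set t].
  by rewrite e; congr span; apply/seteqP; split=> x /=; rewrite inE => /eqP.
(* With t = 0 the maximal ideal would be zero, which leaves no chain of two primes. *)
exists t => //; apply/eqP => t0.
have [_ /(_ (leqnn _)) [P [pP sP]]] := dO 1%N.
have [_] := sP 0%N isT; apply => x P1x.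
have : nonunits O x by apply: nonunits_sub P1x => //; case: (pP 1%N isT).
rewrite et t0 => /span1P-/(_ sO) [a _ ->]; rewrite mulr0.
by case: (pP 0%N isT) => /ideal_submodule/submod0.
Qed.

(** Dividing x by t makes the ideal (x) strictly larger, so noetherian induction on that ideal
    brings the division to an end. *)
Lemma has_order_nat t x : t != 0 -> nonunits O = span O [set t] -> O x -> x != 0 ->
  exists2 u, unit_of u & exists n : nat, x = u * t ^+ n.
Proof.
move=> t0 et Ox x0; move: {2}(span O [set x]) (erefl (span O [set x])) => I.
have idI : O x -> is_ideal O (span O [set x]) by move=> Oy; apply: span_ideal => // _ ->.
move=> eI; have {idI} : is_ideal O I by rewrite -eI; apply: idI.
move=> idI; move: I idI x Ox x0 eI.
apply: (noetherian_ind sO nO) => I idI IH x Ox x0 eI.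
have [mx|nmx] := pselect (nonunits O x); last first.
  by exists x => //; exists 0%N; rewrite mulr1.
have /span1P-/(_ sO) [y Oy xy] : span O [set t] x by rewrite -et.
have y0 : y != 0 by apply: contraNneq x0 => y0; rewrite xy y0 mul0r.
have idy : is_ideal O (span O [set y]) by apply: span_ideal => // _ ->.
have mt : nonunits O t by rewrite et; apply: sub_span.
have prop : I `<` span O [set y].
  rewrite -eI; split.
    apply: span_min; first exact: span_submod.
    by move=> _ ->; apply/span1P => //; exists t; [apply: (ideal_sub idm)|rewrite mulrC].
  move=> /(_ y (sub_span sO erefl)) /span1P-/(_ sO) [a Oa ya].
  have at1 : a * t = 1 by apply: (mulIf y0); rewrite mul1r -mulrA [t * y]mulrC -xy.
  by apply: (nonunits1 lO); rewrite -at1 et; apply/span1P => //; exists a.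
have [u uu [n yu]] := IH _ idy prop y Oy y0 erefl.
by exists u => //; exists n.+1; rewrite xy yu exprSr mulrA.
Qed.

Lemma has_order_exists x : x != 0 -> exists n, has_order O x n.
Proof.
move=> x0; have [a [b [Oa Ob b0 e]]] := fO x; have [t t0 et] := uniformizer.
have a0 : a != 0 by apply: contraNneq x0 => a0; rewrite e a0 mul0r.
have [u uu [n au]] := has_order_nat t0 et Oa a0.
have [w uw [k bw]] := has_order_nat t0 et Ob b0.
have [Ov nv] := unit_ofM uu (unit_ofV uw).
exists (n%:Z - k%:Z), t, (u * w^-1); split=> //.
rewrite e au bw expfzDr // -invr_expz -!exprnP invfM; ring.
Qed.

Lemma has_order_neq0 x n : has_order O x n -> x != 0.
Proof.
move=> [t [u [et Ou nu ->]]]; have [s s0 es] := uniformizer.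
rewrite mulf_neq0 ?(unit_neq0 Ou nu) // expfz_neq0 //; apply/eqP => t0.
have : span O [set t] s by rewrite -et es; apply: sub_span.
by rewrite t0 => /span1P-/(_ sO) [a _]; rewrite mulr0 => /eqP; rewrite (negPf s0).
Qed.

(** [has_order] lets the uniformizer vary; two uniformizers differ by a unit, so any given one
    computes the order. *)
Lemma has_order_at t x n : nonunits O = span O [set t] ->
  has_order O x n <-> exists2 u, unit_of u & x = u * t ^ n.
Proof.
move=> et; split=> [hx|[u [Ou nu] ->]]; last by exists t, u.
have t0 : t != 0.
  have [s s0 es] := uniformizer; apply/eqP => t0.
  have : span O [set t] s by rewrite -et es; apply: sub_span.
  by rewrite t0 => /span1P-/(_ sO) [a _]; rewrite mulr0 => /eqP; rewrite (negPf s0).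
move: hx => [s [u [es Ou nu ->]]].
have [w uw ->] : exists2 w, unit_of w & s = w * t by apply: span1_eq; rewrite // -et -es.
exists (u * w ^ n); first by apply: unit_ofM => //; apply: unit_of_expz.
by rewrite exprzMl ?mulrA // unitfE ?t0 ?unit_of_neq0.
Qed.

Lemma unit_of_uniformizer t n : t != 0 -> nonunits O = span O [set t] ->
  unit_of (t ^ n) -> n = 0.
Proof.
move=> t0 et; have mt : nonunits O t by rewrite et; apply: sub_span.
have h k : ~ unit_of (t ^+ k.+1).
  by case=> _; apply; rewrite exprS; apply: (submodMr sm) => //;
    apply: subringX => //; apply: (ideal_sub idm).
case: n => [[|k]|k] //; first by move/h.
by rewrite -[t ^ _]/((t ^+ k.+1)^-1) => /unit_ofV; rewrite invrK => /h.
Qed.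

Lemma has_order_uniq x n k : has_order O x n -> has_order O x k -> n = k.
Proof.
have [t t0 et] := uniformizer.
move=> /(has_order_at _ _ et) [u uu ->] /(has_order_at _ _ et) [w uw e].
apply/eqP; rewrite -subr_eq0; apply/eqP/(unit_of_uniformizer t0 et).
suff -> : t ^ (n - k) = w * u^-1 by apply: unit_ofM => //; apply: unit_ofV.
have u0 := unit_of_neq0 uu; rewrite expfzDr // -invr_expz.
apply: (mulIf (expfz_neq0 k t0)); rewrite divfK ?expfz_neq0 //.
by rewrite mulrAC -e mulrC mulKf.
Qed.

Lemma has_order_unit u x n : unit_of u -> has_order O x n -> has_order O (u * x) n.
Proof.
have [t t0 et] := uniformizer.
move=> uu /(has_order_at _ _ et) [w uw ->]; apply/(has_order_at _ _ et).
by exists (u * w); [exact: unit_ofM|rewrite mulrA].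
Qed.

Lemma has_order_ratio x y n : has_order O x n -> has_order O y n ->
  exists2 u, unit_of u & y = u * x.
Proof.
have [t t0 et] := uniformizer.
move=> /(has_order_at _ _ et) [u uu ->] /(has_order_at _ _ et) [w uw ->].
exists (w * u^-1); first by apply: unit_ofM => //; apply: unit_ofV.
by rewrite -mulrA mulKf // unit_of_neq0.
Qed.

Lemma has_order_ge0 x n : has_order O x n -> O x <-> (0 <= n).
Proof.
have [t t0 et] := uniformizer; move=> /(has_order_at _ _ et) [u uu ->].
have mt : nonunits O t by rewrite et; apply: sub_span.
have Ot := ideal_sub idm mt.
case: n => k; split=> //; first by move=> _; apply: subringM;
  [exact: sO|case: uu|exact: subringX].
rewrite -[t ^ _]/((t ^+ k.+1)^-1) => h; exfalso; apply: (nonunits1 lO).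
have [Ou' _] := unit_ofV uu.
have -> : 1 = (u^-1 * (u * (t ^+ k.+1)^-1)) * t ^+ k * t.
  by rewrite mulKf ?unit_of_neq0 // -mulrA -exprSr mulVf // expf_neq0.
apply: (submodM sm) => //; apply: subringM => //; last exact: subringX.
exact: subringM.
Qed.

Lemma dvr_valuation x : ~ O x -> nonunits O x^-1.
Proof.
move=> nOx; have x0 : x != 0 by apply/eqP => x0; apply: nOx; rewrite x0; apply: subring0.
have [n hx] := has_order_exists x0; have [t t0 et] := uniformizer.
split; last by right; rewrite invrK.
have /(has_order_at _ _ et) [u uu ex] := hx.
have hV : has_order O x^-1 (- n).
  by apply/(has_order_at _ _ et); exists u^-1; [exact: unit_ofV|rewrite ex invfM invr_expz].
apply/(has_order_ge0 hV); rewrite oppr_ge0; case: (lerP n 0) => // n0.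
by case: nOx; apply/(has_order_ge0 hx)/ltW.
Qed.

End DiscreteValuationRings.

(** * Regular local rings as intersections of discrete valuation rings *)

Section CodimensionOne.
Set Implicit Arguments.
Unset Strict Implicit.
Import GRing.Theory.
Variable K : fieldType.
Variable Z : set (set K).
Hypotheses (regZ : forall O, Z O -> regular_local_ring O)
  (fracZ : forall O, Z O -> is_fraction_field O)
  (char0Z : forall O, Z O -> forall n, n.+1%:R != 0 :> K /\ O n.+1%:R^-1)
  (locZ : forall O q, Z O -> is_prime O q -> Z (localization O q)).
Implicit Types (O E : set K) (x : K).

(* A maximal proper colon ideal (O : g), g in O x, is a prime; if the local ring
   L at that prime has two regular parameters t1, t2, then t1 g and t2 g lie in
   L although g does not, against t1 being a prime element. *)
Lemma codim1_intersection O x : Z O ->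
  (forall E, Z E -> krull_dim E 1 -> O `<=` E -> E x) -> O x.
Proof.
move=> ZO hx; apply: contrapT => nOx.
have [[sO _] nO _] := regZ ZO.
have idO := ideal_submodule (subring_ideal sO).
have [g [Mg nOg pp]] := colon_prime sO nO idO (span_submod [set x] sO) (sub_span sO erefl) nOx.
set p := colon O O g in pp; pose L := localization O p.
have ZL : Z L by apply: locZ.
have OL : O `<=` L by apply: sub_localization.
have nLg : ~ L g.
  move=> [a [b [Oa Ob npb e]]]; have b0 := not_prime_neq0 pp npb.
  by apply: npb; split=> //; rewrite [X in _ * X]e mulrC divfK.
have mg y : nonunits L y -> L (y * g).
  rewrite nonunits_localization // => -[a [b [[Oa Oag] Ob npb ->]]].
  by exists (a * g), b; split=> //; rewrite mulrAC.
have rL := regZ ZL; have [lL nL [s rs]] := rL; have [sL _] := lL.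
(* The number of parameters is the dimension of L. With none, L is a field, hence all of K; with
   one, L is a codimension one point containing O, so x and its multiple g lie in L. *)
case: s rs => [|t1 [|t2 s]] rs.
- have [_ em] := rs; have [u [v [Lu Lv v0 e]]] := fracZ ZL g.
  apply: nLg; rewrite e; apply: subringM => //; apply: unit_inv => //.
  by rewrite em span_nil => /= v00; rewrite v00 eqxx in v0.
- have [dL _] := rs; have Lx : L x by apply: hx.
  have /span1P-/(_ sO) [a Oa e] := Mg.
  by apply: nLg; rewrite e; apply: subringM => //; apply: OL.
have [t10 pt1 nt2] := regular_parameter_prime lL nL (char0Z ZL) rs.
have [_ em] := rs.
have mt1 : nonunits L t1 by rewrite em; apply: sub_span => //=; rewrite mem_head.
have mt2 : nonunits L t2 by rewrite em; apply: sub_span => //=; rewrite !inE eqxx orbT.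
have : span L [set t1] (t1 * g).
  apply: (primeP pt1 _ (mg _ mt1) _ nt2); first by case: mt2.
  by apply/span1P => //; exists (t2 * g); [exact: mg|ring].
move=> /span1P-/(_ sL) [c Lc e]; apply: nLg.
by have -> : g = c by apply: (mulfI t10); rewrite e mulrC.
Qed.

(** It amounts to x / f being in O, which is tested in the discrete valuation rings E above O: if x
    / f is not in E, then f / x is in the maximal ideal of E. *)
Lemma integral_over_principal R I O f x : Z O -> is_subring R -> R `<=` O -> f != 0 ->
  is_ideal R I -> I `<=` span O [set f] -> integral_over_ideal R I x -> span O [set f] x.
Proof.
move=> ZO sR RO f0 idI If [n [c [hc e]]].
have [[sO _] _ _] := regZ ZO; apply/span1P => //; exists (x / f); last by rewrite divfK.
apply: codim1_intersection ZO _ => E ZE dE OE; apply: contrapT => nE.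
have [lE _ _] := regZ ZE; have [sE _] := lE.
have := dvr_valuation (regZ ZE) (fracZ ZE) dE nE; rewrite invf_div => mE.
have x0 : x != 0 by apply/eqP => x0; apply: nE; rewrite x0 mul0r; apply: subring0.
have cE i : (0 < i <= n)%N -> E (c i / f ^+ i).
  move=> /hc; have sEf : submodule R [set y | E (y / f ^+ i)].
    split; [by rewrite /= mul0r; apply: subring0| |].
      by move=> y z /= Ey Ez; rewrite mulrDl; apply: subringD.
    by move=> a y Ra /= Ey; rewrite -mulrA; apply: subringM => //; apply/OE/RO.
  apply: (span_min sEf) => _ [h [Ih ->]] /=.
  rewrite -[X in _ / f ^+ X](card_ord i) -prodr_const -prodf_div.
  elim/big_ind: _ => [|y z|j _]; [exact: subring1|exact: subringM|].
  have /span1P-/(_ sO) [a Oa ->] := If _ (Ih j).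
  by rewrite mulfK //; apply: OE.
have smE := ideal_submodule (nonunits_ideal lE).
apply: (nonunits1 lE).
(* This is the integral equation divided by x ^ n. Each term is in the maximal ideal of E, because f
   / x is, i is positive, and c i, being in I ^ i, is divisible by f ^ i in E. *)
have -> : 1 = \sum_(1 <= i < n.+1) - (c i / f ^+ i) * (f / x) ^+ i.
  apply: (mulfI (expf_neq0 n x0)); rewrite mulr1 mulr_sumr.
  move/eqP: e; rewrite addr_eq0 => /eqP e; rewrite [LHS]e -sumrN.
  apply: eq_big_nat => i /andP[_]; rewrite ltnS => ni.
  rewrite -[in RHS](subnK ni) exprD expr_div_n.
  by field; rewrite !expf_neq0.
rewrite big_nat; apply: (submod_sum smE) => i /andP[i0 ni].
have Ei := cE i; rewrite i0 -ltnS ni in Ei; apply: (submodM smE).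
  by apply: subringN => //; apply: Ei.
case: i i0 {ni Ei} => // i _; rewrite exprS.
by apply: (submodMr smE) => //; apply: subringX => //; case: mE.
Qed.

End CodimensionOne.

(** * Valuation rings and integral closure of ideals *)

Section Valuations.
Set Implicit Arguments.
Unset Strict Implicit.
Import GRing.Theory.
Variable K : fieldType.
Implicit Types (A B I J M N S V R : set K) (x y z : K) (P Q : {poly K}).

(** For a subring A this is A[x], and for an ideal M of A the extension of M to A[x]. Polynomials
    are kept in view because the arguments run on their degrees. *)
Definition poly_values M x : set K :=
  [set y | exists2 P : {poly K}, forall i, M P`_i & y = P.[x]].

Lemma poly_values_submod A B M x : is_subring A -> submodule A M ->
  (forall a m, B a -> M m -> M (a * m)) -> submodule (poly_values B x) (poly_values M x).
Proof.
move=> sA sM BM; split.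
- by exists 0; rewrite ?horner0 // => i; rewrite coef0; apply: submod0 sM.
- move=> _ _ [P hP ->] [Q hQ ->]; exists (P + Q); last by rewrite hornerD.
  by move=> i; rewrite coefD; apply: (submodD sM).
- move=> _ _ [P hP ->] [Q hQ ->]; exists (P * Q); last by rewrite hornerM.
  by move=> i; rewrite coefM; apply: (submod_sum sM) => j _; apply: BM.
Qed.

Lemma poly_values_subring A x : is_subring A -> is_subring (poly_values A x).
Proof.
move=> sA; have [h0 hD hM] :=
  poly_values_submod x sA (ideal_submodule (subring_ideal sA)) (@subringM _ _ sA).
have h1 c : A c -> poly_values A x c.
  move=> Ac; exists c%:P; rewrite ?hornerC // => i; rewrite coefC.
  by case: ifP => // _; apply: subring0.
apply/is_subringP; split=> //; first exact/h1/(subring1 sA).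
move=> y z hy hz; rewrite -mulN1r; apply: hD => //; apply: hM => //.
by apply: h1; apply: subringN => //; apply: subring1.
Qed.

Lemma sub_poly_values M x : M 0 -> M `<=` poly_values M x.
Proof.
move=> M0 c Mc; exists c%:P; rewrite ?hornerC // => i; rewrite coefC.
by case: ifP.
Qed.

Lemma poly_values_var A x : is_subring A -> poly_values A x x.
Proof.
move=> sA; exists 'X; rewrite ?hornerX // => i; rewrite coefX.
by case: eqP => _; [apply: subring1|apply: subring0].
Qed.

(* If both polynomials have coefficients in a proper ideal, the leading term of
   the one of larger degree can be cancelled by means of the other one. *)
Lemma one_poly_values B M x : is_subring B -> is_ideal B M -> ~ M 1 -> x != 0 ->
  poly_values M x 1 -> poly_values M x^-1 1 -> False.
Proof.
move=> sB idM nM1 x0 [P hP eP] [Q hQ eQ].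
have sM := ideal_submodule idM; have MB := ideal_sub idM.
move: {2}(size P + size Q)%N (leqnn (size P + size Q)%N) => k.
elim: k => [|k IHk] in x x0 P hP eP Q hQ eQ *.
  rewrite leqn0 addn_eq0 size_poly_eq0 => /andP[/eqP P0 _].
  by move/eqP: eP; rewrite P0 horner0 oner_eq0.
wlog QP : x x0 P hP eP Q hQ eQ / (size Q <= size P)%N.
  move=> W; have [QP|/ltnW PQ] := leqP (size Q) (size P).
    exact: (W x x0 P hP eP Q hQ eQ QP).
  by rewrite addnC; apply: (W x^-1) => //; rewrite ?invr_eq0 ?invrK.
move=> szk; case sP: (size P) => [|n].
  by move/eqP: sP eP; rewrite size_poly_eq0 => /eqP ->; rewrite horner0 => /eqP;
    rewrite oner_eq0.
case: n sP => [|n] sP.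
  apply: nM1; move: eP; rewrite horner_coef sP big_ord1 mulr1 => ->; exact: hP.
pose b := Q`_0; pose a := P`_n.+1.
(* Since Q(1/x) = 1, the element (1 - b) x ^ (n + 1) is a combination of lower powers of x, with the
   coefficients of Q reversed. Multiplying P(x) = 1 by 1 - b and substituting removes the top term;
   the summand b restores the value 1. *)
pose P' := b%:P + (1 - b) *: (\poly_(i < n.+1) P`_i) + a *: (\poly_(i < n.+1) Q`_(n.+1 - i)).
apply: (IHk x x0 P' _ _ Q hQ eQ).
- have coefp E i : (forall j, M (E j)) -> M (\poly_(j < n.+1) E j)`_i.
    by move=> hE; rewrite coef_poly; case: ifP => // _; apply: submod0 sM.
  move=> i; rewrite !coefD !coefZ coefC; apply: (submodD sM); first apply: (submodD sM).
  + by case: ifP => _; [apply: hQ|apply: submod0 sM].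
  + apply: (submodM sM); last exact: coefp.
    by apply: (subringB sB); [apply: subring1|apply/MB/hQ].
  + by apply: (submodM sM); [apply/MB/hP|apply: coefp].
- rewrite !hornerD !hornerZ hornerC !horner_poly.
  have e1 : \sum_(i < n.+1) P`_i * x ^+ i = 1 - a * x ^+ n.+1.
    by rewrite eP horner_coef sP [in RHS]big_ord_recr /= addrK.
  have e2 : \sum_(i < n.+1) Q`_(n.+1 - i) * x ^+ i = x ^+ n.+1 - b * x ^+ n.+1.
    transitivity (\sum_(i < n.+2) Q`_(n.+1 - i) * x ^+ i - b * x ^+ n.+1).
      by rewrite [in RHS]big_ord_recr /= subnn addrK.
    congr (_ - _); rewrite -[RHS]mulr1 eQ (@horner_coef_wide _ n.+2); last by rewrite -sP.
    rewrite mulr_sumr (reindex_inj rev_ord_inj); apply: eq_bigr => i _ /=.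
    have ile : (i <= n.+1)%N by rewrite -ltnS.
    have -> : x ^+ n.+1 = x ^+ (n.+1 - i) * x ^+ i by rewrite -exprD subnK.
    by rewrite subSS subKn // exprVn; field; rewrite expf_neq0.
  by rewrite e1 e2; ring.
- rewrite -ltnS; apply: leq_trans szk; rewrite ltn_add2r sP ltnS.
  apply: leq_trans (size_polyD _ _) _; rewrite geq_max; apply/andP; split.
    apply: leq_trans (size_polyD _ _) _; rewrite geq_max; apply/andP; split.
      by apply: leq_trans (size_polyC_leq1 _) _.
    by apply: leq_trans (size_scale_leq _ _) (size_poly _ _).
  by apply: leq_trans (size_scale_leq _ _) (size_poly _ _).
Qed.

(** Chevalley's extension theorem: a subring maximal among those over A in which J does not generate
    the unit ideal is a valuation ring. *)
Lemma dominating_valuation A J : is_subring A -> is_ideal A J -> ~ J 1 ->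
  exists V, [/\ valuation_ring V, A `<=` V & J `<=` nonunits V].
Proof.
move=> sA idJ nJ1; have JA := ideal_sub idJ.
pose good B := [/\ is_subring B, A `<=` B & ~ span B J 1].
have goodA : good A.
  by split=> // /(span_min (ideal_submodule idJ) (@subset_refl _ _)).
have [|B [goodB maxB]] := @Zorn_bigcup K [set B | B = set0 \/ good B].
  move=> F FP totF; have [nex|] := pselect (forall B, F B -> B = set0).
    by left; apply/seteqP; split=> // x [B /nex ->].
  move=> /existsNP [B0 /not_implyP [FB0 nB0]]; right.
  have goodF B x : F B -> B x -> good B by move=> FB Bx; case: (FP B FB) => // B00;
    rewrite B00 in Bx.
  have [sB0 AB0 nB01] : good B0 by case: (FP B0 FB0).
  have comp B C x y : F B -> F C -> B x -> C y -> exists D, [/\ F D, D x & D y].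
    move=> FB FC Bx Cy; have [BC|CB] := totF B C FB FC.
      by exists C; split=> //; apply: BC.
    by exists B; split=> //; apply: CB.
  (* An expression of 1 by J over the union involves finitely many coefficients, so it lives over
     one member of the chain. N records this: it is a submodule over the union that contains J but
     not 1. *)
  pose N : set K := [set x | exists B, [/\ F B, good B & span B J x]].
  split.
  - apply/is_subringP; split; first by exists B0 => //; apply: subring1.
      move=> x y [B FB Bx] [C FC Cy]; have [D [FD Dx Dy]] := comp _ _ _ _ FB FC Bx Cy.
      by exists D => //; have [sD _ _] := goodF _ _ FD Dx; apply: subringB.
    move=> x y [B FB Bx] [C FC Cy]; have [D [FD Dx Dy]] := comp _ _ _ _ FB FC Bx Cy.
    by exists D => //; have [sD _ _] := goodF _ _ FD Dx; apply: subringM.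
  - by move=> x Ax; exists B0 => //; apply: AB0.
  - have sN : submodule (\bigcup_(X in F) X) N.
      split.
      + by exists B0; split=> //; apply: submod0 (span_submod _ _).
      + move=> x y [B [FB gB Bx]] [C [FC gC Cy]]; have [sB _ _] := gB; have [sC _ _] := gC.
        have [BC|CB] := totF B C FB FC.
          exists C; split=> //; apply: (submodD (span_submod J sC)) => //.
          exact: span_mono Bx.
        exists B; split=> //; apply: (submodD (span_submod J sB)) => //.
        exact: span_mono Cy.
      + move=> a x [B FB Ba] [C [FC gC Cx]]; have gB := goodF _ _ FB Ba.
        have [sB _ _] := gB; have [sC _ _] := gC.
        have [BC|CB] := totF B C FB FC.
          by exists C; split=> //; apply: (submodM (span_submod J sC)) => //; apply: BC.
        exists B; split=> //; apply: (submodM (span_submod J sB)) => //.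
        exact: span_mono Cx.
    move=> /(span_min sN) -/(_ _)[|B [_ [_ _ nB] /nB//]].
    by move=> x Jx; exists B0; split=> //; apply: sub_span.
have {}goodB : good B.
  case: goodB => // B0; case: (maxB A); last by right.
  by rewrite B0; split=> // /(_ 1 (subring1 sA)).
have [sB AB nB1] := goodB; have JB : J `<=` B by apply: subset_trans AB.
have sSp := span_submod J sB; have idSp : is_ideal B (span B J) by apply: span_ideal.
exists B; split=> //; last first.
  move=> x Jx; split; first exact: JB.
  have [->|x0] := eqVneq x 0; [by left|right=> Bx; apply: nB1].
  by rewrite -(mulVf x0); apply: (submodM sSp) => //; apply: sub_span.
split=> // x.
(* For y outside B the ring B[y] is strictly larger than B, so by maximality J generates the unit
   ideal in it. *)
have one y : ~ B y -> poly_values (span B J) y 1.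
  move=> nBy; apply: contrapT => n1; apply: (maxB (poly_values B y)).
    split; first by apply: sub_poly_values; apply: subring0.
    by move=> h; apply/nBy/h; apply: poly_values_var.
  right; split; first exact: poly_values_subring.
    by apply: subset_trans AB _; apply: sub_poly_values; apply: subring0.
  have sV := poly_values_submod y sB sSp (fun a m Ba => submodM sSp (x := m) Ba).
  move=> /(span_min sV) h; apply: n1; apply: h => z Jz.
  by apply: sub_poly_values; [apply: submod0 sSp|apply: sub_span].
apply: contrapT => /not_orP [nBx nBVx].
have x0 : x != 0 by apply/eqP => x0; apply: nBx; rewrite x0; apply: subring0.
exact: (one_poly_values sB idSp nB1 x0 (one _ nBx) (one _ nBVx)).
Qed.

Lemma valuation_ring_local V : valuation_ring V -> local_ring V.
Proof.
move=> [sV totV]; split=> //.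
have scal a x : V a -> nonunits V x -> nonunits V (a * x).
  move=> Va [Vx [->|nVx]]; first by rewrite mulr0; split; [apply: subring0|left].
  split; first exact: subringM.
  have [->|ax0] := eqVneq (a * x) 0; [by left|right=> Vax; apply: nVx].
  have /andP[a0 x0] : (a != 0) && (x != 0) by rewrite -negb_or -mulf_eq0.
  have -> : x^-1 = a * (a * x)^-1 by field; rewrite ?a0 ?x0.
  exact: subringM.
split=> //; first by move=> x [].
  by split; [apply: subring0|left].
move=> x y mx my; have [->|x0] := eqVneq x 0; first by rewrite add0r.
have [->|y0] := eqVneq y 0; first by rewrite addr0.
have [h|] := totV (x / y).
  have -> : x + y = (x / y + 1) * y by field; rewrite ?y0.
  by apply: scal => //; apply: subringD => //; apply: subring1.
rewrite invf_div => h.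
have -> : x + y = (y / x + 1) * x by field; rewrite ?x0.
by apply: scal => //; apply: subringD => //; apply: subring1.
Qed.

Lemma span_mul A S T U : is_subring A -> (forall s t, S s -> T t -> U (s * t)) ->
  forall x y, span A S x -> span A T y -> span A U (x * y).
Proof.
move=> sA STU x y Sx Ty; have sU := span_submod U sA.
have sub z : (forall s, S s -> span A U (s * z)) -> span A U (x * z).
  move=> h; have sM : submodule A [set w | span A U (w * z)].
    split; first by rewrite /= mul0r; apply: submod0 sU.
      by move=> v w /= hv hw; rewrite mulrDl; apply: (submodD sU).
    by move=> a w Aa /= hw; rewrite -mulrA; apply: (submodM sU).
  exact: (span_min sM h).
apply: sub => s Ss; have sM : submodule A [set w | span A U (s * w)].
  split; first by rewrite /= mulr0; apply: submod0 sU.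
    by move=> v w /= hv hw; rewrite mulrDr; apply: (submodD sU).
  by move=> a w Aa /= hw; rewrite mulrCA; apply: (submodM sU).
by apply: (span_min sM) Ty => t Tt; apply: sub_span => //; apply: STU.
Qed.

Lemma ideal_powD A I i j x y : is_subring A -> ideal_pow A I i x -> ideal_pow A I j y ->
  ideal_pow A I (i + j) (x * y).
Proof.
move=> sA; apply: span_mul => // _ _ [f [If ->]] [g [Ig ->]].
exists (fun k => match fintype.split k with inl a => f a | inr b => g b end); split.
  by move=> k; case: fintype.split.
rewrite big_split_ord /=; congr (_ * _); apply: eq_bigr => k _.
  by rewrite -[lshift _ _]/(unsplit (inl k)) unsplitK.
by rewrite -[rshift _ _]/(unsplit (inr k)) unsplitK.
Qed.

Lemma ideal_pow0 A I : is_subring A -> A `<=` ideal_pow A I 0.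
Proof.
move=> sA x Ax; rewrite -[x]mulr1; apply: (submodM (span_submod _ sA)) => //.
by apply: sub_span => //; exists (fun=> 0); split=> [[]//|]; rewrite big_ord0.
Qed.

Lemma ideal_pow1 A I : is_subring A -> I `<=` ideal_pow A I 1.
Proof.
by move=> sA x Ix; apply: sub_span => //; exists (fun=> x); rewrite big_ord1.
Qed.

(* A' = R[I/x] is the ring of the values at 1/x of the polynomials with i-th
   coefficient in I^i.  If x is not integral over I, then (I/x)A' is proper, and
   in a valuation ring dominating it x is not in IV. *)
Lemma integral_of_valuations R I x : is_subring R -> is_ideal R I -> x != 0 ->
  (forall V, valuation_ring V -> R `<=` V -> span V I x) -> integral_over_ideal R I x.
Proof.
move=> sR idI x0 hV; pose pw := ideal_pow R I.
have spw i : submodule R (pw i) by apply: span_submod.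
pose rees (P : {poly K}) := forall i, pw i P`_i.
have reesD P Q : rees P -> rees Q -> rees (P + Q).
  by move=> hP hQ i; rewrite coefD; apply: (submodD (spw i)).
have reesM P Q : rees P -> rees Q -> rees (P * Q).
  move=> hP hQ i; rewrite coefM; apply: (submod_sum (spw i)) => j _.
  have ji : (j <= i)%N by rewrite -ltnS.
  by rewrite -[X in pw X](subnKC ji); exact: ideal_powD sR (hP j) (hQ _).
have reesC c : R c -> rees c%:P.
  by move=> Rc [|i]; rewrite coefC /=; [apply: ideal_pow0|apply: submod0 (spw _)].
pose A' : set K := [set y | exists2 P, rees P & y = P.[x^-1]].
(* The condition on the constant term makes this the ideal of A' generated by the a / x with a in
   I. *)
pose J : set K := [set y | exists P, [/\ rees P, P`_0 = 0 & y = P.[x^-1]]].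
have sA' : is_subring A'.
  apply/is_subringP; split.
  - by exists 1%:P; [apply: reesC; apply: subring1|rewrite hornerC].
  - move=> _ _ [P hP ->] [Q hQ ->]; exists (P + (-1)%:P * Q).
      by apply: reesD => //; apply: reesM => //; apply: reesC; apply: subringN => //;
        apply: subring1.
    by rewrite hornerD hornerM hornerC mulN1r.
  - by move=> _ _ [P hP ->] [Q hQ ->]; exists (P * Q); [apply: reesM|rewrite hornerM].
have idJ : is_ideal A' J.
  split.
  - by move=> _ [P [hP _ ->]]; exists P.
  - exists 0; split; rewrite ?coef0 ?horner0 // => i.
    by rewrite coef0; apply: submod0 (spw i).
  - move=> _ _ [P [hP P0 ->]] [Q [hQ Q0 ->]]; exists (P + Q).
    by split; [apply: reesD|rewrite coefD P0 Q0 addr0|rewrite hornerD].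
  - move=> _ _ [P hP ->] [Q [hQ Q0 ->]]; exists (P * Q).
    by split; [apply: reesM|rewrite coef0M Q0 mulr0|rewrite hornerM].
have [[P [hP P0 eP]]|nJ1] := pselect (J 1).
  (* P(1/x) = 1 multiplied by x ^ n, with n = [size P], is an equation of integral dependence,
     because P has no constant term. *)
  exists (size P), (fun i => - P`_i); split=> [i _|]; first exact: (submodN sR (spw i)).
  have {}eP : \sum_(1 <= i < (size P).+1) P`_i * x^-1 ^+ i = 1.
    rewrite eP (@horner_coef_wide _ (size P).+1) // -(big_mkord xpredT (fun i => P`_i * x^-1 ^+ i)).
    by rewrite big_ltn // P0 mul0r add0r.
  rewrite -[X in X + _]mulr1 -eP mulr_sumr -big_split /= big_nat big1 // => i /andP[_].
  rewrite ltnS => ni; rewrite -[in X in X + _](subnK ni) exprD exprVn.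
  by field; rewrite expf_neq0.
have [V [vV A'V JV]] := dominating_valuation sA' idJ nJ1.
have RV : R `<=` V.
  by move=> c Rc; apply: A'V; exists c%:P; [apply: reesC|rewrite hornerC].
have lV := valuation_ring_local vV; have [sV idm] := lV.
have sM : submodule V [set y | nonunits V (y / x)].
  have sm := ideal_submodule idm; split; first by rewrite /= mul0r; apply: submod0 sm.
    by move=> y z /= hy hz; rewrite mulrDl; apply: (submodD sm).
  by move=> a y Va /= hy; rewrite -mulrA; apply: (submodM sm).
exfalso; apply: (nonunits1 lV); rewrite -(mulfV x0).
apply: (span_min sM) (hV V vV RV) => a Ia /=; apply: JV; exists (a *: 'X); split.
- move=> i; rewrite coefZ coefX; case: i => [|[|i]]; rewrite ?mulr0 ?mulr1.
  + exact: submod0 (spw _).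
  + exact: ideal_pow1.
  + exact: submod0 (spw _).
- by rewrite coefZ coefX mulr0.
- by rewrite hornerZ hornerX.
Qed.

End Valuations.

(** * Hilbert's basis theorem *)

Section HilbertBasis.
Set Implicit Arguments.
Unset Strict Implicit.
Import GRing.Theory.
Variable K : fieldType.
Implicit Types (A B I J M S : set K) (x y z : K) (P Q : {poly K}).

Section OneGenerator.
Variables (A : set K) (x : K).
Hypotheses (sA : is_subring A) (nA : noetherian A).
Variables (I : set K).
Let B := poly_values A x.
Hypothesis idI : is_ideal B I.

Let sB : is_subring B. Proof. exact: poly_values_subring. Qed.
Let AB : A `<=` B. Proof. by apply: sub_poly_values; apply: subring0. Qed.
Let sI : submodule A I. Proof. exact: submod_sub AB (ideal_submodule idI). Qed.

Let over P : Prop := forall i, A P`_i.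

Let overB P Q : over P -> over Q -> over (P - Q).
Proof. by move=> hP hQ i; rewrite coefB; apply: subringB. Qed.

(** As x may be algebraic over A, degrees are taken in A[X] and not in A[x]: the preimage of I is
    what supplies the leading coefficients. Degrees smaller than n are allowed, so that 0 is
    included. *)
Definition leading n : set K :=
  [set c | exists P : {poly K}, [/\ over P, (size P <= n.+1)%N, I P.[x] & P`_n = c]].

Lemma leading_ideal n : is_ideal A (leading n).
Proof.
split.
- by move=> _ [P [hP _ _ <-]].
- exists 0; split; rewrite ?size_poly0 ?horner0 ?coef0 //; last exact: submod0 sI.
  by move=> i; rewrite coef0; apply: subring0.
- move=> _ _ [P [hP sP IP <-]] [Q [hQ sQ IQ <-]]; exists (P + Q); split.
  + by move=> i; rewrite coefD; apply: subringD.
  + by apply: leq_trans (size_polyD _ _) _; rewrite geq_max sP.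
  + by rewrite hornerD; apply: (submodD sI).
  + by rewrite coefD.
- move=> a _ Aa [P [hP sP IP <-]]; exists (a *: P); split.
  + by move=> i; rewrite coefZ; apply: subringM.
  + exact: leq_trans (size_scale_leq _ _) sP.
  + by rewrite hornerZ; apply: (submodM sI).
  + by rewrite coefZ.
Qed.

Lemma leading_mono n m : (n <= m)%N -> leading n `<=` leading m.
Proof.
move=> /subnKC <- _ [P [hP sP IP <-]]; exists ('X^(m - n) * P); split.
- by move=> i; rewrite coefXnM; case: ifP => // _; apply: subring0.
- apply: leq_trans (size_polyMleq _ _) _; rewrite size_polyXn /=.
  by rewrite -addSn addnC leq_add2r.
- rewrite hornerM hornerXn; apply: (submodM (ideal_submodule idI)) => //.
  by apply: subringX => //; apply: poly_values_var.
- by rewrite coefXnM ltnNge leq_addl /= addnK.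
Qed.

Lemma size_sub_leading n P Q : (size P <= n.+1)%N -> (size Q <= n.+1)%N -> P`_n = Q`_n ->
  (size (P - Q)%R <= n)%N.
Proof.
move=> sP sQ e; apply/leq_sizeP => j; rewrite leq_eqVlt => /orP[/eqP<-|nj].
  by rewrite coefB e subrr.
by rewrite coefB (leq_sizeP _ _ sP) // (leq_sizeP _ _ sQ) // subrr.
Qed.

(** Induction on the degree bound: lifts of finitely many generators of [leading n] cancel the
    coefficient at n. The span is over A, since multiplying by x would raise the degree. *)
Lemma bounded_degree_fg n : exists s : seq K, [set` s] `<=` I /\
  forall P, over P -> (size P <= n)%N -> I P.[x] -> span A [set` s] P.[x].
Proof.
elim: n => [|n [s [sI' hs]]].
  exists [::]; split=> [y /=|P _]; first by rewrite in_nil.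
  by rewrite leqn0 size_poly_eq0 => /eqP -> _; rewrite horner0;
    apply: submod0 (span_submod _ sA).
have [cs ecs] := nA (leading_ideal n).
have lift (c : K) : exists Q : {poly K}, leading n c ->
    [/\ over Q, (size Q <= n.+1)%N, I Q.[x] & Q`_n = c].
  by have [[Q hQ]|nc] := pselect (leading n c); [exists Q|exists 0].
have [f hf] := choice lift.
pose s' := s ++ [seq (f c).[x] | c <- cs].
have csn c : c \in cs -> leading n c by move=> ccs; rewrite ecs; apply: sub_span.
have s'I : [set` s'] `<=` I.
  move=> y /=; rewrite mem_cat => /orP[/sI'//|/mapP[c /csn /hf [_ _ Ifc _] ->]] //.
have ss' := span_submod [set` s'] sA.
exists s'; split=> // P hP sP IP.
have [Q [hQ sQ eQ sQ']] : exists Q,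
  [/\ over Q, (size Q <= n.+1)%N, Q`_n = P`_n & span A [set` s'] Q.[x]].
  pose N : set K := [set c | exists Q : {poly K},
    [/\ over Q, (size Q <= n.+1)%N, Q`_n = c & span A [set` s'] Q.[x]]].
  have sN : submodule A N.
    split.
    + exists 0; split; rewrite ?size_poly0 ?horner0 ?coef0 //; last exact: submod0 ss'.
      by move=> i; rewrite coef0; apply: subring0.
    + move=> _ _ [Q [hQ sQ <- Qx]] [T [hT sT <- Tx]]; exists (Q + T); split.
      * by move=> i; rewrite coefD; apply: subringD.
      * by apply: leq_trans (size_polyD _ _) _; rewrite geq_max sQ.
      * by rewrite coefD.
      * by rewrite hornerD; apply: (submodD ss').
    + move=> a _ Aa [Q [hQ sQ <- Qx]]; exists (a *: Q); split.
      * by move=> i; rewrite coefZ; apply: subringM.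
      * exact: leq_trans (size_scale_leq _ _) sQ.
      * by rewrite coefZ.
      * by rewrite hornerZ; apply: (submodM ss').
  have : span A [set` cs] P`_n by rewrite -ecs; exists P.
  apply: (span_min sN) => c /= ccs; have [h1 h2 h3 h4] := hf c (csn c ccs).
  exists (f c); split=> //; apply: sub_span => //=.
  by rewrite mem_cat; apply/orP; right; apply/mapP; exists c.
have -> : P.[x] = (P - Q).[x] + Q.[x] by rewrite hornerD hornerN subrK.
apply: (submodD ss') => //.
have : span A [set` s] (P - Q).[x].
  apply: hs; [exact: overB|exact: size_sub_leading|].
  by rewrite hornerD hornerN; apply: (submodB sA sI) => //; apply: (span_min sI) sQ'.
by apply: span_mono => // y /= ys; rewrite mem_cat ys.
Qed.

(** The union of the ideals of leading coefficients is finitely generated, hence reached at some N.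
    Generators for degrees at most N suffice: above N the leading coefficient is cancelled by a
    power of X times a polynomial of degree at most N. *)
Lemma ideal_fg : exists s : seq K, I = span B [set` s].
Proof.
pose L : set K := [set c | exists n, leading n c].
have idL : is_ideal A L.
  split.
  - by move=> c [n]; apply: ideal_sub; apply: leading_ideal.
  - by exists 0%N; apply: submod0 (ideal_submodule (leading_ideal _)).
  - move=> c d [n nc] [m md]; exists (maxn n m).
    apply: (submodD (ideal_submodule (leading_ideal _))).
      by apply: leading_mono nc; apply: leq_maxl.
    by apply: leading_mono md; apply: leq_maxr.
  - by move=> a c Aa [n nc]; exists n; apply: (submodM (ideal_submodule (leading_ideal _))).
have [cs Lcs] := nA idL.
have [N hN] : exists N : nat, [set` cs] `<=` leading N.
  have : forall c, c \in cs -> L c by move=> c ccs; rewrite Lcs; apply: sub_span.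
  elim: cs {Lcs} => [|c cs IH] hcs; first by exists 0%N => c /=; rewrite in_nil.
  have [n hn] : exists n : nat, [set` cs] `<=` leading n.
    by apply: IH => d dcs; apply: hcs; rewrite inE dcs orbT.
  have [m mc] := hcs c (mem_head _ _); exists (maxn n m) => d /=.
  rewrite inE => /orP[/eqP->|/hn]; first by apply: leading_mono mc; apply: leq_maxr.
  by apply: leading_mono; apply: leq_maxl.
have LN : L `<=` leading N by rewrite Lcs; apply: span_min => //;
  exact: ideal_submodule (leading_ideal N).
have [s [s_I hs]] := bounded_degree_fg N.+1; exists s; apply/seteqP; split; last first.
  by apply: span_min => //; apply: ideal_submodule.
have ss := span_submod [set` s] sB.
have small P : over P -> (size P <= N.+1)%N -> I P.[x] -> span B [set` s] P.[x].
  by move=> hP sP IP; apply: (span_mono sB AB (@subset_refl _ _)); apply: hs.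
suff main n P : over P -> (size P <= n)%N -> I P.[x] -> span B [set` s] P.[x].
  move=> y Iy; have [P hP e] := ideal_sub idI Iy.
  by rewrite e; apply: (main (size P)) => //; rewrite -e.
elim: n P => [|n IHn] P hP sP IP; first by apply: small => //; apply: leq_trans sP _.
have [nN|Nn] := leqP n N; first by apply: small => //; apply: leq_trans sP _.
have [Q [hQ sQ IQ eQ]] : leading N P`_n by apply: LN; exists n, P.
pose T := 'X^(n - N) * Q; have hT : over T.
  by move=> i; rewrite coefXnM; case: ifP => // _; apply: subring0.
have xB : B (x ^+ (n - N)) by apply: subringX => //; apply: poly_values_var.
have Tx : span B [set` s] T.[x].
  by rewrite hornerM hornerXn; apply: (submodM ss) => //; apply: small.
have -> : P.[x] = (P - T).[x] + T.[x] by rewrite hornerD hornerN subrK.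
apply: (submodD ss) => //; apply: IHn; first exact: overB.
  apply: size_sub_leading => //.
    apply: leq_trans (size_polyMleq _ _) _; rewrite size_polyXn /=.
    by rewrite -[X in (_ <= X.+1)%N](subnK (ltnW Nn)) -addnS leq_add2l.
  by rewrite coefXnM ltnNge leq_subr /= subKn ?eQ // ltnW.
rewrite hornerD hornerN; apply: (submodB sA sI) => //.
by apply: (span_min (ideal_submodule idI)) Tx.
Qed.

End OneGenerator.

Lemma adjoin_nil A : is_subring A -> adjoin A [set` [::]] = A.
Proof.
move=> sA; apply/seteqP; split; last by move=> y Ay; apply: sub_adjoin; left.
by apply: adjoin_min => // y [//|/=]; rewrite in_nil.
Qed.

Lemma adjoin_cons A x s : is_subring A ->
  adjoin A [set` x :: s] = poly_values (adjoin A [set` s]) x.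
Proof.
move=> sA; have sC := adjoin_subring A [set` s].
have sV := poly_values_subring x sC.
have sub : adjoin A [set` s] `<=` poly_values (adjoin A [set` s]) x.
  by apply: sub_poly_values; apply: subring0.
apply/seteqP; split.
  apply: adjoin_min => // y [Ay|/=]; first by apply: sub; apply: sub_adjoin; left.
  rewrite inE => /orP[/eqP->|ys]; first exact: poly_values_var.
  by apply: sub; apply: sub_adjoin; right.
have sD := adjoin_subring A [set` x :: s].
move=> _ [P hP ->]; rewrite horner_coef.
apply: (submod_sum (ideal_submodule (subring_ideal sD))) => i _.
apply: (subringM sD); last first.
  by apply: (subringX sD); apply: sub_adjoin; right; rewrite /= mem_head.
apply: (adjoin_min sD _ (hP i)) => y [Ay|/= ys]; apply: sub_adjoin; [by left|right].
by rewrite /= inE ys orbT.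
Qed.

Theorem finite_type_noetherian A B : is_subring A -> noetherian A -> finite_type A B ->
  noetherian B.
Proof.
move=> sA nA [s ->]; elim: s => [|x s IHs]; first by rewrite adjoin_nil.
rewrite adjoin_cons // => I idI.
exact: (ideal_fg (adjoin_subring A [set` s]) IHs idI).
Qed.

End HilbertBasis.

(** * Divisors and ideals on a model *)

Section DivisorsAndIdeals.
Set Implicit Arguments.
Unset Strict Implicit.
Import Order.TTheory GRing.Theory Num.Theory.
Variable K : fieldType.
Variables (R : set K) (Y : set (set K)).
Hypotheses (rR : regular_local_ring R) (fR : is_fraction_field R)
  (char0R : forall n, n.+1%:R != 0 :> K /\ R n.+1%:R^-1)
  (normalR : forall x, integral_over_ideal R R x -> R x)
  (modelY : proper_birational_model R Y) (smoothY : smooth Y).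
Implicit Types (A O E I V : set K) (x f g : K) (D : set K -> int).

Let sR : is_subring R. Proof. by case: rR => -[]. Qed.
Let nR : noetherian R. Proof. by case: rR. Qed.

Lemma model_chart O : Y O -> exists2 A, finite_type R A & Spec A O.
Proof. by case: modelY => -[n [A [hA ->]]] _ [i _ AO]; exists (A i). Qed.

Lemma model_sub O : Y O -> R `<=` O.
Proof.
move=> /model_chart [A /finite_type_subring [sA RA] AO].
by apply: subset_trans RA _; apply: Spec_sub.
Qed.

Let sY O : Y O -> is_subring O. Proof. by case/smoothY => -[]. Qed.
Let fY O : Y O -> is_fraction_field O.
Proof. by move=> YO; apply: fraction_field_sub fR => //; apply: model_sub. Qed.
Let cY O : Y O -> forall n, n.+1%:R != 0 :> K /\ O n.+1%:R^-1.
Proof. by move=> YO n; have [h Rn] := char0R n; split=> //; apply: model_sub YO _ Rn. Qed.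

Lemma model_localization O q : Y O -> is_prime O q -> Y (localization O q).
Proof.
case: modelY => -[n [A [hA ->]]] _ [i _ AO] pq; exists i => //.
by apply: Spec_localization => //; case: (finite_type_subring (hA i)).
Qed.

Let codim1 O x : Y O -> (forall E, prime_divisors Y E -> O `<=` E -> E x) -> O x.
Proof.
move=> YO hx; apply: (codim1_intersection smoothY fY cY model_localization YO).
by move=> E YE dE; apply: hx.
Qed.

(** The quotient of two local equations is a unit along every prime divisor through O, hence lies in
    O by [codim1], and so does its inverse. *)
Lemma local_equation_span D O f g : Y O -> local_equation Y D O f ->
  local_equation Y D O g -> span O [set f] = span O [set g].
Proof.
move=> YO; have sub f' g' : local_equation Y D O f' -> local_equation Y D O g' ->
    span O [set f'] `<=` span O [set g'].
  move=> [f0 hf] [g0 hg]; apply: span_min; first exact: span_submod (sY YO).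
  move=> _ ->; apply/span1P; [exact: sY|exists (f' / g'); last by rewrite divfK].
  apply: codim1 => // E pE OE; have [YE dE] := pE.
  have [u [Eu _] ->] := has_order_ratio (smoothY YE) dE (hg E pE OE) (hf E pE OE).
  by rewrite mulfK.
by move=> hf hg; apply/seteqP; split; apply: sub.
Qed.

Lemma sheafN_local_equation D O f : Y O -> local_equation Y D O f ->
  sheafN Y D O = span O [set f].
Proof.
move=> YO hf; apply/seteqP; split=> [x [g hg]|x fx]; last by exists f.
by rewrite (local_equation_span YO hf hg).
Qed.

(** The case x = 0 is kept apart because [integral_of_valuations] divides by x. *)
Lemma integral_of_stalks I x : is_ideal R I -> (forall O, Y O -> span O I x) ->
  x = 0 \/ integral_over_ideal R I x.
Proof.
move=> idI hx; have [->|x0] := eqVneq x 0; [by left|right].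
apply: integral_of_valuations => // V vV RV; have [_ hV] := modelY.
have [O [[YO [OV _]] _]] := hV V vV RV.
by apply: (span_mono _ OV (@subset_refl _ I)) (hx O YO); case: vV.
Qed.

Lemma model_global_functions x : (forall O, Y O -> O x) -> R x.
Proof.
move=> hx; have [O YO|->|] := @integral_of_stalks R x (subring_ideal sR).
- rewrite -[x]mulr1; apply: (submodM (span_submod R (sY YO))); first exact: hx.
  by apply: sub_span; [exact: sY|exact: subring1].
- exact: subring0.
- exact: normalR.
Qed.

Lemma global_sections_ideal_sheaf I : integrally_closed_ideal R I ->
  global_sections Y (ideal_sheaf I) = I.
Proof.
move=> [idI hI]; apply/seteqP; split=> [x hx|x Ix O YO]; last first.
  by apply: sub_span => //; apply: sY.
have Rx : R x.
  apply: model_global_functions => O YO.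
  apply: (span_min (ideal_submodule (subring_ideal (sY YO)))) (hx O YO).
  exact: subset_trans (ideal_sub idI) (model_sub YO).
have [->|] := integral_of_stalks idI hx; last exact: hI.
exact: submod0 (ideal_submodule idI).
Qed.

(** * From divisors to ideals *)

Section GloballyGenerated.
Variable D : set K -> int.
Hypothesis ggD : gg_effective_divisors Y D.
Local Notation I := (ideal_of_divisor Y D).

Lemma gg_local_equation O : Y O -> exists f, local_equation Y D O f.
Proof.
move=> YO; case: ggD => _ _ /(_ O YO) gg.
have : sheafN Y D O 0 by rewrite gg; apply: submod0 (span_submod _ (sY YO)).
by move=> [f hf _]; exists f.
Qed.

Lemma effective_local_equation O f : Y O -> local_equation Y D O f -> O f.
Proof.
case: ggD => _ eD _ YO [f0 hf]; apply: codim1 => // E pE OE.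
have [YE dE] := pE; exact/(has_order_ge0 (smoothY YE) dE (hf E pE OE)).
Qed.

Lemma ideal_of_divisor_span O f : Y O -> local_equation Y D O f -> I `<=` span O [set f].
Proof. by move=> YO hf x /(_ O YO); rewrite (sheafN_local_equation YO hf). Qed.

Lemma ideal_of_divisor_ideal : is_ideal R I.
Proof.
have sF O : Y O -> submodule R (sheafN Y D O).
  move=> YO; have [f hf] := gg_local_equation YO.
  rewrite (sheafN_local_equation YO hf); apply: submod_sub (model_sub YO) _.
  exact: span_submod (sY YO).
split.
- move=> x Ix; apply: model_global_functions => O YO.
  have [f hf] := gg_local_equation YO.
  apply: (span_min (ideal_submodule (subring_ideal (sY YO)))) (ideal_of_divisor_span YO hf Ix).
  by move=> _ ->; apply: effective_local_equation hf.
- by move=> O YO; apply: submod0 (sF O YO).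
- by move=> x y hx hy O YO; apply: (submodD (sF O YO)); [apply: hx|apply: hy].
- by move=> a x Ra hx O YO; apply: (submodM (sF O YO)) => //; apply: hx.
Qed.

Lemma ideal_of_divisor_sheaf : sheaf_eq Y (ideal_sheaf I) (sheafN Y D).
Proof. by move=> O YO; case: ggD => _ _ /(_ O YO) ->. Qed.

Lemma ideal_of_divisor_closed : closed_ideals_invertible_on R Y I.
Proof.
split; first split; first exact: ideal_of_divisor_ideal.
  move=> x Rx ix O YO; have [f hf] := gg_local_equation YO.
  rewrite (sheafN_local_equation YO hf).
  apply: (integral_over_principal smoothY fY cY model_localization YO sR _ _
    ideal_of_divisor_ideal _ ix); first exact: model_sub.
    by case: hf.
  exact: ideal_of_divisor_span.
move=> O YO; have [f hf] := gg_local_equation YO; exists f; first by case: hf.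
by rewrite (ideal_of_divisor_sheaf YO) (sheafN_local_equation YO hf).
Qed.

End GloballyGenerated.

(** For I invertible on Y the default of [xget] is never reached, by [divisor_of_idealP]; the value
    0 off the prime divisors is imposed by [is_divisor]. *)
Definition divisor_of_ideal I : set K -> int := fun E =>
  if `[< prime_divisors Y E >] then
    xget 0 [set n | exists2 g, span E I = span E [set g] & has_order E g n]
  else 0.

(** * From ideals to divisors *)

Section InvertibleIdeals.
Variable I : set K.
Hypothesis (closedI : closed_ideals_invertible_on R Y I).
Local Notation DI := (divisor_of_ideal I).

Let idI : is_ideal R I. Proof. by case: closedI => -[]. Qed.

Lemma divisor_of_idealP E : prime_divisors Y E ->
  exists2 g, span E I = span E [set g] & has_order E g (DI E).
Proof.
move=> pE; have [YE dE] := pE; rewrite /divisor_of_ideal asboolT //.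
have [_ /(_ E YE) [g g0 eg]] := closedI.
have [n hn] := has_order_exists (smoothY YE) (fY YE) dE g0.
by case: xgetP => [m _ //|/(_ n)[]]; exists g.
Qed.

Lemma divisor_of_ideal_order E g : prime_divisors Y E -> span E I = span E [set g] ->
  has_order E g (DI E).
Proof.
move=> pE eg; have [YE dE] := pE; have [h eh hh] := divisor_of_idealP pE.
have h0 := has_order_neq0 (smoothY YE) dE hh.
have [u uu ->] := span1_eq (smoothY YE) h0 (etrans (esym eh) eg).
exact: (has_order_unit (smoothY YE) dE).
Qed.

(** A generator of the stalk at O also generates I over every larger ring E, so one element computes
    the multiplicities of all prime divisors through O. *)
Lemma ideal_sheaf_generator_equation O g : Y O -> g != 0 ->
  span O I = span O [set g] -> local_equation Y DI O g.
Proof.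
move=> YO g0 eg; split=> // E pE OE; have [YE dE] := pE; apply: divisor_of_ideal_order => //.
have sE := sY YE; have sO := sY YO.
apply/seteqP; split; apply: span_min; try exact: span_submod.
  move=> x Ix; apply: (span_mono sE OE (@subset_refl _ [set g])); rewrite -eg.
  exact: sub_span.
move=> _ ->; apply: (span_mono sE OE (@subset_refl _ I)); rewrite eg.
exact: sub_span.
Qed.

Lemma divisor_of_ideal_sheaf : sheaf_eq Y (ideal_sheaf I) (sheafN Y DI).
Proof.
move=> O YO; have [_ /(_ O YO) [g g0 eg]] := closedI.
by rewrite eg (sheafN_local_equation YO (ideal_sheaf_generator_equation YO g0 eg)).
Qed.

Lemma divisor_of_ideal_effective : effective DI.
Proof.
move=> E; have [pE|npE] := pselect (prime_divisors Y E); last first.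
  by rewrite /divisor_of_ideal asboolF.
have [g eg hg] := divisor_of_idealP pE; have [YE dE] := pE.
apply/(has_order_ge0 (smoothY YE) dE hg).
have : span E I g by rewrite eg; apply: sub_span => //; apply: sY.
apply: (span_min (ideal_submodule (subring_ideal (sY YE)))).
exact: subset_trans (ideal_sub idI) (model_sub YE).
Qed.

Lemma support_prime_divisor E : DI E != 0 -> prime_divisors Y E.
Proof. by rewrite /divisor_of_ideal; case: asboolP => // _; rewrite eqxx. Qed.

(** Otherwise a generator of I at E would be a unit, of order 0. Thus any nonzero x in I vanishes on
    the whole support, which [finite_prime_divisors] then shows to be finite. *)
Lemma support_nonunits E : DI E != 0 -> I `<=` nonunits E.
Proof.
move=> DE; have pE := support_prime_divisor DE; have [YE dE] := pE.
have [g eg hg] := divisor_of_idealP pE; have rE := smoothY YE.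
have [lE _ _] := rE; have sm := ideal_submodule (nonunits_ideal lE).
have Eg : E g by apply/(has_order_ge0 rE dE hg); apply: divisor_of_ideal_effective.
have mg : nonunits E g.
  apply: contrapT => nmg; move/eqP: DE; apply.
  apply: (has_order_uniq rE dE hg); have [t _ et] := uniformizer rE dE.
  by apply/(has_order_at rE dE _ _ et); exists g => //; rewrite mulr1.
have sub : span E I `<=` nonunits E by rewrite eg; apply: span_min => // _ ->.
by apply: subset_trans sub; apply: sub_span; apply: sY.
Qed.

(* A prime divisor on which x vanishes is the localization of a chart at a prime
   that is minimal over x. *)
Lemma finite_prime_divisors x : R x -> x != 0 ->
  finite_set [set E | prime_divisors Y E /\ nonunits E x].
Proof.
move=> Rx x0; case: modelY => -[n [A [hA YA]]] _.
have sA i : is_subring (A i) by case: (finite_type_subring (hA i)).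
have Ax i : A i x by case: (finite_type_subring (hA i)) => _; apply.
have idx i : is_ideal (A i) (span (A i) [set x]) by apply: span_ideal => // _ ->.
have nA i := finite_type_noetherian sR nR (hA i).
have [Q hQ] := choice (fun i => finite_primes_below (sA i) (nA i) (idx i)).
apply: (@sub_finite_set _ _ (\bigcup_(i in [set: 'I_n]) (localization (A i) @` Q i))).
  move=> E [[YE dE] mx]; have := YE; rewrite YA => -[i _ [p pp eE]].
  exists i => //; exists p => //.
  have [fQ Qp mQ] := hQ i; have sAi := sA i.
  have sp : submodule (A i) p by case: pp => /ideal_submodule.
  have px : p x.
    move: mx; rewrite eE nonunits_localization // => h.
    exact: (extend_prime_restrict pp pp (@subset_refl _ p) (Ax i) h).
  have [q Qq qp] : exists2 q, Q i q & q `<=` p.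
    by apply: mQ => //; apply: span_min => // _ ->.
  have [pq xq] := Qp q Qq; suff -> : p = q by [].
  have qx : q x by apply: xq; apply: sub_span.
  apply/seteqP; split=> //; apply: contrapT => npq.
  (* If q were smaller than p, then 0, q, p would extend to a chain of length two in E, which has
     dimension one; its first inclusion is strict because q contains x, which is nonzero. *)
  pose P (k : nat) := if k is k'.+1 then
    if k' is _.+1 then extend_prime (A i) p p else extend_prime (A i) p q else [set 0 : K].
  suff : (2 <= 1)%N by [].
  apply/dE; exists P; rewrite eE; have pL := localization_subring sAi pp; split.
    move=> [|[|k]] _ /=; first exact: prime0.
      exact: extend_prime_prime.
    exact: extend_prime_prime.
  have ext r y : r y -> extend_prime (A i) p r y.
    by move=> ry; exists y, 1; rewrite divr1; split=> //; [exact: subring1|case: pp].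
  move=> [|[|//]] _ /=; split.
  - by move=> _ ->; apply: ext; case: pq => /ideal_submodule/submod0.
  - by move=> /(_ x (ext _ _ qx)) /eqP; rewrite (negPf x0).
  - by move=> _ [a [b [qa Ab npb ->]]]; exists a, b; split=> //; apply: qp.
  - move=> h; apply: npq => y py; apply: (extend_prime_restrict pp pq qp).
      by case: pp => /ideal_sub + _ _; apply.
    exact/h/ext.
apply: bigcup_finite => [|i _]; first exact: finite_finset.
by apply: finite_image; case: (hQ i).
Qed.

Lemma divisor_of_ideal_divisor : is_divisor Y DI.
Proof.
split; first by move=> E /support_prime_divisor.
(* A nonzero element of I is obtained from an invertible, hence nonzero, stalk; a component of the
   support provides the point at which to take it. *)
have [[E0 DE0]|nex] := pselect (exists E, DI E != 0); last first.
  rewrite (_ : [set _ | _] = set0); first exact: finite_set0.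
  by apply/seteqP; split=> // E DE; case: nex; exists E.
have pE0 := support_prime_divisor DE0; have [YE0 _] := pE0.
have [x Ix x0] : exists2 x, I x & x != 0.
  apply: contrapT => nex.
  have [g g0 eg] : exists2 g, g != 0 & span E0 I = span E0 [set g].
    by case: closedI => _; apply.
  have : span E0 I g by rewrite eg; apply: sub_span => //; apply: sY.
  have s0 : submodule E0 [set 0] by case: (prime0 (sY YE0)) => /ideal_submodule.
  move=> /(span_min s0) h; move/eqP: g0; apply; apply: h => y Iy.
  by apply: contrapT => /eqP y0; apply: nex; exists y.
apply: sub_finite_set (finite_prime_divisors (ideal_sub idI Ix) x0) => E DE.
by split; [exact: support_prime_divisor|exact: support_nonunits].
Qed.

Lemma ideal_of_divisor_of_ideal : ideal_of_divisor Y DI = I.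
Proof.
case: closedI => cI _; rewrite -[RHS](global_sections_ideal_sheaf cI).
apply: eq_bigcapr => O YO; exact/esym/divisor_of_ideal_sheaf.
Qed.

Lemma divisor_of_ideal_gg : gg_effective_divisors Y DI.
Proof.
split; [exact: divisor_of_ideal_divisor|exact: divisor_of_ideal_effective|].
move=> O YO; rewrite -[global_sections _ _]/(ideal_of_divisor Y DI).
by rewrite ideal_of_divisor_of_ideal -(divisor_of_ideal_sheaf YO).
Qed.

(** The stalk at E contains 0, which forces D to have a local equation f there; f generates I at E,
    so both multiplicities are the order of f. *)
Lemma divisor_of_ideal_uniq D : is_divisor Y D ->
  sheaf_eq Y (ideal_sheaf I) (sheafN Y D) -> D = DI.
Proof.
move=> [dD _] hD; apply/funext => E; have [pE|npE] := pselect (prime_divisors Y E).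
  have [YE dE] := pE; have [g eg hg] := divisor_of_idealP pE.
  have : sheafN Y D E 0.
    by rewrite -(hD E YE); apply: submod0 (span_submod _ (sY YE)).
  move=> [f hf _]; have ef : span E I = span E [set f].
    by rewrite -(sheafN_local_equation YE hf) -(hD E YE).
  apply: (has_order_uniq (smoothY YE) dE (x := f)); last exact: divisor_of_ideal_order.
  by case: hf => _; apply.
rewrite /divisor_of_ideal asboolF //; apply/eqP; apply: contrapT => /negP DE.
by apply: npE; apply: dD.
Qed.

End InvertibleIdeals.

Lemma divisor_of_ideal_of_divisor D : gg_effective_divisors Y D ->
  divisor_of_ideal (ideal_of_divisor Y D) = D.
Proof.
move=> ggD; apply/esym/divisor_of_ideal_uniq.
- exact: ideal_of_divisor_closed.
- by case: ggD.
- exact: ideal_of_divisor_sheaf.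
Qed.

End DivisorsAndIdeals.

(** * Normality of a smooth germ *)

Section SmoothGerms.
Set Implicit Arguments.
Unset Strict Implicit.
Import GRing.Theory.

(** Normality is [integral_over_principal] for the ideal R and f = 1, applied to the points of Spec
    A, which are regular and stable under localization. Positive integers are invertible because A
    contains the image of k. *)
Lemma smooth_germ_normal (k K : fieldType) (iota : {rmorphism k -> K}) (R : set K) :
  [pchar k] =i pred0 -> is_fraction_field R -> germ_of_smooth_variety iota R ->
  (forall n, n.+1%:R != 0 :> K /\ R n.+1%:R^-1) /\
  forall x, integral_over_ideal R R x -> R x.
Proof.
move=> char_k fR [A [ftA rA AR]].
have sk : is_subring (range iota).
  apply/is_subringP; split; first by exists 1; rewrite ?rmorph1.
    by move=> _ _ [a _ <-] [b _ <-]; exists (a - b); rewrite ?rmorphB.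
  by move=> _ _ [a _ <-] [b _ <-]; exists (a * b); rewrite ?rmorphM.
have [sA kA] := finite_type_subring ftA.
have inv O : A `<=` O -> forall n, n.+1%:R != 0 :> K /\ O n.+1%:R^-1.
  move=> AO n; rewrite -(rmorph_nat iota) -fmorphV fmorph_eq0.
  split; last by apply/AO/kA; exists (n.+1%:R^-1).
  by move/pcharf0P: char_k => ->.
have AR' := Spec_sub sA AR; have sR := Spec_subring sA AR.
have fA := fraction_field_Spec sA AR fR.
split; first exact: inv.
move=> x ix; have R1 : span R [set 1] `<=` R.
  apply: span_min; first exact: ideal_submodule (subring_ideal sR).
  by move=> _ ->; apply: subring1.
apply: R1; apply: (@integral_over_principal _ (Spec A) rA _ _ _ R R R 1 x) => //.
- by move=> O AO; apply: fraction_field_sub fA => //; apply: Spec_sub.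
- by move=> O AO; apply: inv; apply: Spec_sub.
- by move=> O q AO pq; apply: Spec_localization.
- exact: oner_neq0.
- exact: subring_ideal.
- by move=> y Ry; apply/span1P => //; exists y => //; rewrite mulr1.
Qed.

End SmoothGerms.

Theorem theorem3p9 (k : closedFieldType) (char_k : [pchar k] =i pred0)
    (K : fieldType) (iota : {rmorphism k -> K})
    (R : set K) (d : nat) (a : set K) (Y : set (set K)) :
  is_fraction_field R ->
  regular_local_ring R -> krull_dim R d -> (2 <= d)%N ->
  germ_of_smooth_variety iota R ->
  is_ideal R a -> (exists2 x, a x & x != 0) ->
  log_resolution R a Y ->
  set_bij (gg_effective_divisors Y) (closed_ideals_invertible_on R Y)
    (@ideal_of_divisor K Y) /\
  exists divisor_of_ideal : set K -> (set K -> int),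
    [/\ forall I, closed_ideals_invertible_on R Y I ->
          forall D, (is_divisor Y D /\ sheaf_eq Y (ideal_sheaf I) (sheafN Y D))
                    <-> D = divisor_of_ideal I,
        set_fun (closed_ideals_invertible_on R Y) (gg_effective_divisors Y)
          divisor_of_ideal,
        {in gg_effective_divisors Y,
          cancel (@ideal_of_divisor K Y) divisor_of_ideal}
      & {in closed_ideals_invertible_on R Y,
          cancel divisor_of_ideal (@ideal_of_divisor K Y)}].
Proof.
move=> fR rR _ _ germR _ _ [modelY smoothY _ _].
have [char0R normalR] := smooth_germ_normal char_k fR germR.
have closedD := ideal_of_divisor_closed rR fR char0R normalR modelY smoothY.
have DK := divisor_of_ideal_of_divisor rR fR char0R normalR modelY smoothY.
have ggI := divisor_of_ideal_gg rR fR char0R normalR modelY smoothY.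
have IK := ideal_of_divisor_of_ideal rR fR char0R normalR modelY smoothY.
split.
  split=> [D /closedD //|D D'|I cI].
    by rewrite !in_setE => ggD ggD' e; rewrite -(DK D ggD) e DK.
  by exists (divisor_of_ideal Y I); [apply: ggI|apply: IK].
exists (divisor_of_ideal Y); split.
- move=> I cI D; split=> [[dD hD]|->].
    exact: (divisor_of_ideal_uniq rR fR char0R modelY smoothY cI dD hD).
  split; first by case: (ggI I cI).
  exact: (divisor_of_ideal_sheaf rR fR char0R modelY smoothY cI).
- by move=> I /ggI.
- by move=> D; rewrite in_setE => /DK.
- by move=> I; rewrite in_setE => /IK.
Qed.
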